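(* Let $(\Gamma_N(k))_{k\ge 1}$ be a stationary Wigner process of covariance (correlation) function $r$ and variance $\beta^2$, and let $D_N$ be a sequence of random diagonal $N\times N$ matrices, independent of the Wigner process, with i.i.d. real diagonal entries $\lambda_j$ of law $\mu$, with $\mu_1=\mu(\lambda)=1$ and finite moments $\mu_k=\mu(\lambda^k)$ for all $k$. Put $$Q_k^N=N^{-k/2}D_N\prod_{m=1}^k\big(\Gamma_N(m)D_N\big),\qquad B_k^N(r)=N^{-1}\,\mathbb{E}\big(\mathrm{tr}(Q_k^N)\big).$$ Let $B^r$ be the bare Green function on $\mathcal{F}$ with weights $B^r_k=\beta^2 r(2k-1)$, $k\ge1$, let $\psi_\mu(z)=\sum_{k\ge0}\mu_{k+1}z^k$, and let $\omega_\mu(t)=\prod_{v}\mu_{d(v)+1}$ (product over the nodes $v$ of $t$). Then, as $N\to\infty$, for every integer $k\ge 0$, $$B_{2k}^N(r)\longrightarrow B_{2k}(r)=\frac{1}{B^r_{k+1}}\sum_{t\in\mathcal{F}_{k+1}}B^r(t)\,\omega_\mu(t),\qquad B_{2k+1}^N(r)\longrightarrow 0.$$ Assume that the covariance is such that there exists a power series $L^r(z)$ with $B^r_k=L^r(k)/k$ for all $k\ge1$. Then the formal power series $$Y(z)=\sum_{k\ge1}z^k\,B^r_k\,B_{2(k-1)}(r)$$ solves $$Y'=L^r(\theta+1)\,\psi_\mu(Y).$$ Moreover, $$\sum_{k\ge1}z^k\,B_{2(k-1)}(r)=z\,\psi_\mu(Y).$$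
   Context: Trees: $\mathcal{F}_n$ is the set of rooted plane trees with $n$ nodes (the children of each node are linearly ordered), $\mathcal{F}=\bigcup_{n\ge1}\mathcal{F}_n$; $|t|$ is the number of nodes of $t$ and $d(v)$ the outdegree (number of children) of node $v$. Bare Green function: for a real sequence $(B_k)_{k\ge1}$, $B:\mathcal{F}\to\mathbb{R}$ is defined recursively by $B(t)=B_{|t|}\prod_{i=1}^k B(t_i)$, where $t_1,\dots,t_k$ are the subtrees of $t$ rooted at the children of the root. The quotient $B(t)/B_{|t|}$ is understood as $\prod_{i=1}^k B(t_i)$ (also if $B_{|t|}=0$). Wigner matrices of variance $\beta^2$: real random $N\times N$ matrices $\Gamma_N=(\gamma_{i,j})_{1\le i,j\le N}$, one for each $N$, such that $\gamma_{i,j}=\gamma_{j,i}$; the $\gamma_{i,j}$, $i\le j$, are independent and centered; $\mathbb{E}(\gamma_{i,j}^2)=\beta^2$ for $i\ne j$; and for every $k\ge2$, $\mathbb{E}(|\gamma_{i,j}|^k)\le c_k$ with $c_k$ independent of $i\le j$ and of $N$. Wigner process of variance $\beta^2$ and correlation function $r$, where $r(k,k)=1$, $|r(k,m)|\le1$, $r(k,m)=r(m,k)$: a sequence $\Gamma_N(k)=(\gamma_{i,j}(k))_{1\le i,j\le N}$, $k\ge1$, such that each $\Gamma_N(k)$ is a Wigner matrix of variance $\beta^2$; for $i\le j$, each process $(\gamma_{i,j}(k))_k$ is independent of the others; and for $i\neq j$ and $k\ge m$, $\mathbb{E}(\gamma_{i,j}(k)\gamma_{i,j}(m))=\beta^2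 r(k,m)$. It is stationary when $r(k,m)=r(|k-m|)$ (same letter $r$ for the one-variable function). Operators: $\theta=z\frac{d}{dz}$, and for a power series $L$, $L(\theta+1)$ is the formal operator $L(\theta+1)\big(\sum_{m\ge0}a_mz^m\big)=\sum_{m\ge0}a_mL(m+1)z^m$. Identities involving $Y$ are between formal power series. *)

(* Defs.v *)
From HB Require Import structures.
From mathcomp Require Import all_boot all_order all_algebra finmap.
From mathcomp Require Import all_classical all_reals all_analysis.

Set Implicit Arguments.
Unset Strict Implicit.
Unset Printing Implicit Defensive.

Import Order.TTheory GRing.Theory Num.Theory.
Import numFieldNormedType.Exports.

Local Open Scope classical_set_scope.
Local Open Scope ring_scope.

(** * Rooted plane trees *)

(* A tree is a root together with the ordered list of its child subtrees. *)
Inductive ptree : Type := PNode of seq ptree.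

Definition children (t : ptree) : seq ptree := let: PNode s := t in s.

HB.instance Definition _ := gen_eqMixin ptree.
HB.instance Definition _ := gen_choiceMixin ptree.

Fixpoint nodes (t : ptree) : nat :=
  let: PNode s := t in (sumn [seq nodes u | u <- s]).+1.

(* The outdegrees of all the nodes of t, listed in prefix order. *)
Fixpoint outdegrees (t : ptree) : seq nat :=
  let: PNode s := t in size s :: flatten [seq outdegrees u | u <- s].

Definition plane_trees (n : nat) : set ptree := [set t | nodes t = n].

(* [plane_trees n] is finite, so that the finitely supported sums
   [\sum_(t \in plane_trees n) _] below are the actual sums over all trees. *)
Lemma finite_plane_trees (n : nat) : finite_set (plane_trees n).
Proof.
have fin_forest m : finite_set
    [set s : seq ptree | (sumn [seq nodes u | u <- s] <= m)%N].
  elim: m => [|m IHm].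
    apply: (@sub_finite_set _ _ [set [::]]); last exact: finite_set1.
    by case=> [|[u] s].
  pose f (u s : seq ptree) := PNode u :: s.
  apply: (@sub_finite_set _ _ ([set [::]] `|`
      [set f u s | u in [set s | (sumn [seq nodes u | u <- s] <= m)%N]
                 & s in [set s | (sumn [seq nodes u | u <- s] <= m)%N]])).
    case=> [|[u] s] /=; first by left.
    rewrite addSn ltnS => le_m; right.
    have le_u : (sumn [seq nodes v | v <- u] <= m)%N.
      by apply: leq_trans le_m; rewrite leq_addr.
    have le_s : (sumn [seq nodes v | v <- s] <= m)%N.
      by apply: leq_trans le_m; rewrite leq_addl.
    by exists u => //; exists s.
  by rewrite finite_setU; split; [exact: finite_set1 | exact: finite_image2].
apply: (@sub_finite_set _ _ (PNode @`
    [set s | (sumn [seq nodes u | u <- s] <= n)%N])).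
  by move=> [s] /= <-; exists s => //=.
exact: finite_image.
Qed.

Section bare_green.
Variable R : realType.
Implicit Types B : nat -> R.

Fixpoint bare_green B (t : ptree) : R :=
  let: PNode s := t in B (nodes t) * \prod_(x <- [seq bare_green B u | u <- s]) x.

(* B(t) / B_|t|, with the convention that also covers B_|t| = 0. *)
Definition bare_green_quotient B (t : ptree) : R :=
  \prod_(u <- children t) bare_green B u.

Lemma bare_greenE B t :
  bare_green B t = B (nodes t) * bare_green_quotient B t.
Proof. by case: t => s; rewrite /bare_green_quotient /= big_map. Qed.

End bare_green.

(** * Formal power series *)

Section formal_power_series.
Variable R : realType.

(* A formal power series is its sequence of coefficients. *)
Definition fps := nat -> R.
Implicit Types a b : fps.

Definition fps1 : fps := fun m => (m == 0%N)%:R.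
Definition fpsX : fps := fun m => (m == 1%N)%:R.
Definition fps_mul a b : fps := fun m => \sum_(i < m.+1) a i * b (m - i)%N.
Definition fps_exp a k : fps := iter k (fps_mul a) fps1.
Definition fps_deriv a : fps := fun m => m.+1%:R * a m.+1.

(* a(b(z)), for b without constant term: then b^k does not contribute to the
   coefficient of z^m when k > m. *)
Definition fps_comp a b : fps := fun m => \sum_(k < m.+1) a k * fps_exp b k m.

(* \sum_(k >= 1) c_k z^k *)
Definition fps_from1 (c : nat -> R) : fps := fun m => if m is 0 then 0 else c m.

(* L(theta + 1), with theta = z d/dz *)
Definition fps_theta1 (L : R -> R) a : fps := fun m => a m * L m.+1%:R.

End formal_power_series.

(** * Independence *)

Section independence.
Context (R : realType) (d : measure_display) (T : measurableType d).
Variable P : probability T R.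

Definition independent_systems (F G : set (set T)) : Prop :=
  forall A B, F A -> G B -> P (A `&` B) = (P A * P B)%E.

Definition mutually_independent (I : choiceType) (D : set I)
    (F : I -> set (set T)) : Prop :=
  forall J : {fset I}, [set` J] `<=` D ->
  forall E : I -> set T, (forall i, i \in J -> F i (E i)) ->
  P (\bigcap_(i in [set` J]) E i) = (\prod_(i <- J) P (E i))%E.

(* The sigma-algebra generated by the real random variables X i, i in D. *)
Definition sigma_process (I : Type) (D : set I) (X : I -> T -> R) :
    set (set T) :=
  <<s \bigcup_(i in D) preimage_set_system setT (X i) measurable >>.

Definition sigma_variable (X : T -> R) : set (set T) :=
  sigma_process setT (fun _ : unit => X).

End independence.

(** * Wigner matrices and Wigner processes *)

Section wigner.
Context (R : realType) (d : measure_display) (T : measurableType d).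
Variable P : probability T R.

(* Entries of a random N x N matrix. *)
Definition random_entries (N : nat) : Type := 'I_N -> 'I_N -> {RV P >-> R}.

Definition upper_pairs (N : nat) : set ('I_N * 'I_N) :=
  [set p : 'I_N * 'I_N | (p.1 <= p.2)%N].

Record wigner_matrices (beta : R) (G : forall N, random_entries N) : Prop := {
  wigner_sym : forall N i j w, G N i j w = G N j i w ;
  wigner_indep : forall N, mutually_independent P (@upper_pairs N)
    (fun p => sigma_variable (G N p.1 p.2)) ;
  wigner_centered : forall N i j, ('E_P[G N i j] = 0)%E ;
  wigner_variance : forall N i j, i != j ->
    ('E_P[fun w => (G N i j w ^+ 2)%R] = (beta ^+ 2)%R%:E)%E ;
  wigner_moments : exists c : nat -> R, forall N (i j : 'I_N) k, (2 <= k)%N ->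
    ('E_P[fun w => (`|G N i j w| ^+ k)%R] <= (c k)%:E)%E }.

(* Processes are indexed by k >= 1; their value at 0 is never constrained. *)
Definition times : set nat := [set k | (1 <= k)%N].

Record correlation (r : nat -> nat -> R) : Prop := {
  correlation_diag : forall k, times k -> r k k = 1 ;
  correlation_le1 : forall k m, times k -> times m -> `|r k m| <= 1 ;
  correlation_sym : forall k m, times k -> times m -> r k m = r m k }.

Record wigner_process (beta : R) (r : nat -> nat -> R)
    (G : forall N, nat -> random_entries N) : Prop := {
  process_correlation : correlation r ;
  process_wigner : forall k, times k -> wigner_matrices beta (fun N => G N k) ;
  process_indep : forall N, mutually_independent P (@upper_pairs N)
    (fun p => sigma_process times (fun k => G N k p.1 p.2)) ;
  process_covariance : forall N i j k m, i != j -> times m -> (m <= k)%N ->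
    ('E_P[fun w => (G N k i j w * G N m i j w)%R] = (beta ^+ 2 * r k m)%R%:E)%E }.

Definition stationary_wigner_process (beta : R) (r : nat -> R)
    (G : forall N, nat -> random_entries N) : Prop :=
  exists2 r2 : nat -> nat -> R, wigner_process beta r2 G &
    forall k m, times k -> times m -> r2 k m = r `|k%:Z - m%:Z|%N.

(* The diagonal entries of the random matrices are i.i.d. of law mu. *)
Record iid_diagonal (mu : probability (measurableTypeR R) R)
    (lam : forall N, 'I_N -> {RV P >-> R}) : Prop := {
  diagonal_indep : forall N, mutually_independent P setT
    (fun j => sigma_variable (lam N j)) ;
  diagonal_law : forall N j A, measurable A ->
    distribution P (lam N j) A = mu A }.

Definition diagonal_process_independent (lam : forall N, 'I_N -> {RV P >-> R})
    (G : forall N, nat -> random_entries N) : Prop :=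
  forall N, independent_systems P
    (sigma_process setT (fun j => lam N j))
    (sigma_process [set x : nat * ('I_N * 'I_N) | times x.1]
       (fun x => G N x.1 x.2.1 x.2.2)).

Definition Gamma_mx N (G : random_entries N) (w : T) : 'M[R]_N :=
  \matrix_(i, j) G i j w.

Definition D_mx N (lam : 'I_N -> {RV P >-> R}) (w : T) : 'M[R]_N :=
  diag_mx (\row_j lam j w).

Definition Q_mx N (G : nat -> random_entries N) (lam : 'I_N -> {RV P >-> R})
    (k : nat) (w : T) : 'M[R]_N :=
  (N%:R `^ (- (k%:R / 2))) *:
    (D_mx lam w *m \prod_(1 <= m < k.+1) (Gamma_mx (G m) w *m D_mx lam w)).

(* Extended-real valued, so that its convergence to a finite limit also says
   that the trace is eventually integrable. *)
Definition mean_trace (G : forall N, nat -> random_entries N)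
    (lam : forall N, 'I_N -> {RV P >-> R}) (k N : nat) : \bar R :=
  ((N%:R^-1)%R%:E * 'E_P[fun w => \tr (Q_mx (G N) (lam N) k w)])%E.

End wigner.

(** * The limit *)

Section limit.
Variable R : realType.
Variables (beta : R) (r : nat -> R) (mu : probability (measurableTypeR R) R).

Definition moment (k : nat) : R := Rintegral mu setT (fun x => x ^+ k).

(* B^r_k, used for k >= 1 only *)
Definition stationary_weights (k : nat) : R := beta ^+ 2 * r (2 * k - 1)%N.

Definition psi : fps R := fun k => moment k.+1.

Definition omega (t : ptree) : R := \prod_(e <- outdegrees t) moment e.+1.

(* B_{2k}(r) *)
Definition even_limit (k : nat) : R :=
  \sum_(t \in plane_trees k.+1)
    (bare_green_quotient stationary_weights t * omega t).

Definition Y_series : fps R :=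
  fps_from1 (fun k => stationary_weights k * even_limit k.-1).

End limit.

(* Main.v *)
(* Expand E tr(Q_k) as a sum over closed walks x -> p of k steps on {1..N}.
   By independence the term of a walk is a product over vertices of moments of
   mu and over unordered edges e of E(prod_t gamma_e(t)), t ranging over the
   times at which e is traversed; it vanishes if some edge is traversed only
   once.  Otherwise a walk has at most k/2 + 1 distinct vertices, and the
   O(N^d) walks with d vertices are negligible against N^(1 + k/2) unless
   d = k/2 + 1.  In that case the walk traverses a tree, each edge exactly
   twice.  Cutting such a walk at its first return to the root yields two
   vertex-disjoint walks of the same kind and the factor beta^2 r(2a + 1),
   where 2a is the length of the first one, by stationarity.  This recursion
   is also the one satisfied by the coefficients of psi_mu(Y), hence, through
   the decomposition of a plane tree into the forest of its root, by
   [even_limit]. *)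

Require Import Defs.
From HB Require Import structures.
From mathcomp Require Import all_boot all_order all_algebra finmap.
From mathcomp Require Import all_classical all_reals all_analysis.
From mathcomp Require Import measurable_realfun zify ring.

Set Implicit Arguments.
Unset Strict Implicit.
Unset Printing Implicit Defensive.

Import Order.TTheory GRing.Theory Num.Theory.
Import numFieldNormedType.Exports.

Local Open Scope classical_set_scope.
Local Open Scope ring_scope.

(** * Closed walks whose edges are all traversed exactly twice *)

Section distinct_elements.
Variable T : eqType.
Implicit Types (s t : seq T) (z : T).

(** The recursion does not close on the walks that the trace produces. After the first return to the
    root, the rest of the walk starts at a later time, at a vertex visited once more, and must avoid
    the vertices of the excursion. Three parameters record this: the start time [s], the number [j]
    of earlier visits to the root, which raises the order of the moment of mu there, and the set [S]
    of vertices still available. Stationarity removes [s] from the result, and only the cardinal of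
    [S] survives, in a falling factorial. The sum over tree walks is thus an exact identity for each
    N; the limit only involves N^_(n+1) / N^(n+1) and the bound on the other walks. That bound must
    be uniform in N and over all walks of k steps, although no mixed moment across times is
    prescribed beyond order two: a product of entries is dominated by 1 plus a sum of powers of
    single entries. The combinatorics is done for abstract edge and vertex moments. Probability
    serves to identify these, which requires transferring independence from events to expectations
    of unbounded variables. *)

Definition ndistinct s := size (undup s).

Lemma ndistinct_cons z s : ndistinct (z :: s) = ((z \notin s) + ndistinct s)%N.
Proof. by rewrite /ndistinct /=; case: (z \in s). Qed.

Lemma ndistinct1 z : ndistinct [:: z] = 1%N.
Proof. by []. Qed.

Lemma sub_ndistinct s t : {subset s <= t} -> (ndistinct s <= ndistinct t)%N.
Proof.
move=> st; apply: uniq_leq_size; rewrite ?undup_uniq// => z.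
by rewrite !mem_undup; exact: st.
Qed.

Lemma eq_ndistinct s t : s =i t -> ndistinct s = ndistinct t.
Proof.
move=> st; apply/eqP; rewrite eqn_leq !sub_ndistinct// => z;
  by rewrite st.
Qed.

Lemma ndistinct_disjoint_cat s t : ~~ has (mem t) s ->
  ndistinct (s ++ t) = (ndistinct s + ndistinct t)%N.
Proof.
elim: s => //= z s IH; rewrite negb_or => /andP[zt /IH st].
by rewrite !ndistinct_cons mem_cat negb_or zt andbT st addnA.
Qed.

Lemma size_sum_count s : size s = (\sum_(z <- undup s) count_mem z s)%N.
Proof.
elim: s => [|z s IH]; first by rewrite big_nil.
transitivity (\sum_(t <- undup (z :: s)) ((t == z) + count_mem t s))%N; last first.
  by apply: eq_bigr => t _ /=; rewrite eq_sym.
rewrite big_split /= [in RHS](bigID (pred1 z))/=.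
rewrite [X in (_ + X + _)%N]big1 => [|t /negPf-> //].
case: ifPn => zs; last first.
  rewrite !big_cons /= eqxx (count_memPn zs) add0n -IH.
  rewrite big1_seq ?addn0// => t /andP[/eqP -> ]; rewrite mem_undup.
  by rewrite (negPf zs).
rewrite -IH addn0 (eq_bigr (fun=> 1%N)) => [|t /eqP->]; last by rewrite eqxx.
rewrite sum1_count; have /count_uniq_mem -> := undup_uniq s.
by rewrite mem_undup zs.
Qed.

Lemma double_ndistinct s : (ndistinct s).*2 = (\sum_(z <- undup s) 2)%N.
Proof. by rewrite big_const_seq count_predT iter_addn addn0 mul2n. Qed.

Lemma ndistinct_count_ge2 s :
  (forall z, z \in s -> (2 <= count_mem z s)%N) ->
  ((ndistinct s).*2 <= size s)%N.
Proof.
move=> s2; rewrite size_sum_count double_ndistinct.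
rewrite big_seq [leqRHS]big_seq; apply: leq_sum => z.
by rewrite mem_undup; exact: s2.
Qed.

Lemma ndistinct_count_eq2 s :
  (forall z, z \in s -> count_mem z s = 2%N) -> (ndistinct s).*2 = size s.
Proof.
move=> s2; rewrite [RHS]size_sum_count double_ndistinct.
rewrite big_seq [RHS]big_seq; apply: eq_bigr => z.
by rewrite mem_undup => /s2.
Qed.

(** By [size_sum_count] the size is a sum of multiplicities, each at least 2; if the total is at
    most twice the number of terms, none can exceed 2. *)
Lemma count_eq2 s :
  (forall z, z \in s -> (2 <= count_mem z s)%N) ->
  (size s <= (ndistinct s).*2)%N -> forall z, z \in s -> count_mem z s = 2%N.
Proof.
move=> s2 sle z zs; apply/eqP; rewrite eqn_leq s2// andbT.
have zu : z \in undup s by rewrite mem_undup.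
move: sle; rewrite size_sum_count double_ndistinct.
rewrite (big_rem z)//= [leqRHS](big_rem z)//=.
set S := (\sum_(_ <- _) _)%N; set S2 := (\sum_(_ <- _) _)%N.
have : (S2 <= S)%N.
  rewrite /S /S2 big_seq [leqRHS]big_seq; apply: leq_sum => i /mem_rem.
  by rewrite mem_undup => /s2.
by lia.
Qed.

End distinct_elements.

(** * Vertices and edges of a walk *)

Section walks.
Variable N : nat.
Implicit Types (u v x y : 'I_N) (p : seq 'I_N) (e : 'I_N * 'I_N).

(* Unordered pairs are encoded by their representatives in [upper_pairs]. *)
Definition edge u v : 'I_N * 'I_N := if (u <= v)%N then (u, v) else (v, u).

Definition edges x p := pairmap edge x p.

Lemma edgeC u v : edge u v = edge v u.
Proof.
rewrite /edge; case: leqP => [uv|/ltnW ->//]; case: leqP => // vu.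
by have -> : u = v by apply/val_inj/eqP; rewrite eqn_leq uv.
Qed.

Lemma edge_end u v x y : edge u v = edge x y -> (u == x) || (u == y).
Proof.
by rewrite /edge; case: leqP => _; case: leqP => _ [*]; subst; rewrite eqxx ?orbT.
Qed.

Lemma edge_inj u : injective (edge u).
Proof.
move=> v w euv; have /orP[/eqP vu|/eqP//] : (v == u) || (v == w).
  by apply: (@edge_end v u u w); rewrite edgeC.
have /orP[/eqP->|/eqP->//] : (w == u) || (w == v).
  by apply: (@edge_end w u u v); rewrite edgeC -euv.
by [].
Qed.

Lemma edges_end u v x p : edge u v \in edges x p -> u \in x :: p.
Proof.
elim: p x => //= y p IH x; rewrite inE => /orP[/eqP/edge_end|/IH].
  by rewrite !inE; case/orP => ->; rewrite ?orbT.
by rewrite !inE => ->; rewrite orbT.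
Qed.

Lemma edges_edge e x p : e \in edges x p -> exists u v, e = edge u v.
Proof.
by elim: p x => //= y p IH x; rewrite inE => /predU1P[->|/IH//]; exists x, y.
Qed.

Lemma edges_disjoint x p y q e : ~~ has (mem (y :: q)) (x :: p) ->
  e \in edges x p -> e \notin edges y q.
Proof.
move=> /hasPn dis ep; apply/negP => eq.
have [u [v e_uv]] := edges_edge ep; move: ep eq; rewrite e_uv.
by move=> /edges_end/dis/= uNq /edges_end; apply/negP.
Qed.

Lemma edges_cat x p q : edges x (p ++ q) = edges x p ++ edges (last x p) q.
Proof. by elim: p x => //= y p IH x; rewrite IH. Qed.

Lemma size_edges x p : size (edges x p) = size p.
Proof. exact: size_pairmap. Qed.

(* Walking from a visited vertex, each new vertex is reached along a new edge. *)
Lemma ndistinct_extend_walk a b x p :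
  x \in a -> (forall u v, edge u v \in b -> u \in a) ->
  (ndistinct (a ++ p) + ndistinct b <=
   ndistinct (b ++ edges x p) + ndistinct a)%N.
Proof.
elim: p x a b => [|y p IH] x a b xa ba; first by rewrite /= !cats0 addnC.
have ba' u v : edge u v \in edge x y :: b -> u \in y :: a.
  rewrite !inE => /orP[/eqP/edge_end/orP[]/eqP->|/ba ->].
  - by rewrite xa orbT.
  - by rewrite eqxx.
  - by rewrite orbT.
have := IH y (y :: a) (edge x y :: b) (mem_head _ _) ba'.
rewrite (@eq_ndistinct _ ((y :: a) ++ p) (a ++ y :: p)); last first.
  by move=> z; rewrite !(mem_cat, inE) orbCA orbA.
rewrite (@eq_ndistinct _ ((edge x y :: b) ++ _) (b ++ edges x (y :: p))).
  rewrite !(ndistinct_cons y) (ndistinct_cons (edge _ _)).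
  case: (boolP (y \in a)) => ya; first by lia.
  have -> : edge x y \notin b by apply: contra ya; rewrite edgeC => /ba.
  by lia.
by move=> z; rewrite !(mem_cat, inE) orbCA orbA.
Qed.

Lemma ndistinct_walk x p : (ndistinct (x :: p) <= (ndistinct (edges x p)).+1)%N.
Proof.
have := @ndistinct_extend_walk [:: x] [::] x p.
by rewrite mem_head /= addn0 addn1; apply.
Qed.

(** The extremal walks: with every edge traversed twice, [ndistinct_walk] allows at most
    [size p / 2 + 1] vertices. Doubling avoids the division. The empty walk is included. *)
Definition tree_walk x p :=
  [&& last x p == x,
      all (fun e => count_mem e (edges x p) == 2%N) (edges x p) &
      (ndistinct (x :: p)).*2 == (size p).+2].

Lemma tree_walkP x p : reflect
  [/\ last x p = x, (forall e, e \in edges x p -> count_mem e (edges x p) = 2%N) &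
      (ndistinct (x :: p)).*2 = (size p).+2] (tree_walk x p).
Proof.
apply: (iffP and3P) => -[/eqP ? H /eqP ?]; split=> //.
  by move=> e /(allP H)/eqP.
by apply/allP => e /H ->.
Qed.

(** The case of equality in the chain vertices - 1 <= edges <= half the length: both inequalities
    become equalities, and the second one forces the multiplicities to be exactly 2. *)
Lemma tree_walk_ge2 x p : last x p = x ->
  (forall e, e \in edges x p -> (2 <= count_mem e (edges x p))%N) ->
  ((size p).+2 <= (ndistinct (x :: p)).*2)%N -> tree_walk x p.
Proof.
move=> px p2 pV; have := ndistinct_walk x p; have := ndistinct_count_ge2 p2.
rewrite size_edges => leE leV; apply/tree_walkP; split => //; last by lia.
by apply: count_eq2 => //; rewrite size_edges; lia.
Qed.

Lemma ndistinct_walk_ge2 x p :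
  (forall e, e \in edges x p -> (2 <= count_mem e (edges x p))%N) ->
  ((ndistinct (x :: p)).*2 <= (size p).+2)%N.
Proof.
move=> p2; have := ndistinct_walk x p; have := ndistinct_count_ge2 p2.
by rewrite size_edges; lia.
Qed.

Lemma first_occurrence (T : eqType) (z : T) (s : seq T) : z \in s ->
  exists s1 s2, s = s1 ++ z :: s2 /\ z \notin s1.
Proof.
elim: s => // t s IH; rewrite inE; case: eqVneq => [-> _|zt /IH].
  by exists [::], s.
by move=> [s1 [s2 [-> zs1]]]; exists (t :: s1), s2; rewrite inE negb_or zt.
Qed.

(* A tree walk has one more vertex than edges.  If its first excursion from [x]
   did not come back along the first edge, or met the rest of the walk outside
   [x], there would be as many edges as vertices. *)
Lemma tree_walk_first_return x p : tree_walk x p -> p != [::] ->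
  exists y w1 w2, [/\ p = y :: w1 ++ x :: w2, x \notin y :: w1,
    tree_walk y w1, tree_walk x w2 & ~~ has (mem (x :: w2)) (y :: w1)].
Proof.
move=> /tree_walkP[px p2 pV] p0.
have nE := ndistinct_count_eq2 p2; rewrite size_edges in nE.
have xp : x \in p.
  by case: p p0 px {p2 pV nE} => // y p _ <-; rewrite /= mem_last.
have [q [w2 [pE xNq]]] : exists q w2 : seq 'I_N, p = q ++ x :: w2 /\ x \notin q.
  exact: first_occurrence.
rewrite {}pE {xp p0 p} in px p2 pV nE *.
rewrite last_cat /= in px.
case: q xNq p2 pV nE => [_|y w1 xNq] p2 pV nE.
  (* A first step that stays at [x] uses an edge without reaching a new vertex, which loses the one
     vertex in excess. *)
  have := @ndistinct_extend_walk [:: x] [:: edge x x] x w2 (mem_head _ _).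
  have xx u v : edge u v \in [:: edge x x] -> u \in [:: x].
    by rewrite !inE => /eqP/edge_end; rewrite orbb.
  move=> /(_ xx) leE; rewrite cat0s ndistinct_cons mem_head add0n in pV.
  by move: leE pV nE; rewrite !ndistinct1 !cat1s /=; lia.
have yx : y != x by apply: contraNneq xNq => ->; rewrite mem_head.
pose z := last y w1.
have zx : z != x.
  by apply: contraNneq xNq => <-; exact: mem_last.
have edgesE : edges x ((y :: w1) ++ x :: w2) =
    edge x y :: edges y w1 ++ edge x z :: edges x w2.
  by rewrite /= edges_cat /= [edge z x]edgeC.
rewrite edgesE in p2 nE.
have xNw1 u : edge x u \notin edges y w1.
  by apply: contra xNq; exact: edges_end.
(* Otherwise [x] is joined to the excursion by two distinct edges: [x :: y :: w1] has at most as
   many vertices as there are edges in [b], and this persists along [w2]. *)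
have zy : z = y.
  apply/eqP; apply: contraT => zy.
  pose b := edge x y :: edge x z :: edges y w1.
  pose a := x :: y :: w1.
  have ba u v : edge u v \in b -> u \in a.
    rewrite /a /b !inE => /orP[/eqP/edge_end|/orP[/eqP/edge_end|/edges_end]].
    - by rewrite orbA => ->.
    - by case/orP => /eqP->; rewrite ?eqxx// /z -in_cons mem_last orbT.
    - by rewrite inE => ->; rewrite orbT.
  have := @ndistinct_extend_walk a b x w2 (mem_head _ _) ba.
  have := ndistinct_walk y w1.
  rewrite (@eq_ndistinct _ (a ++ w2) (x :: (y :: w1) ++ x :: w2)); last first.
    by move=> u; rewrite /a !(inE, mem_cat); case: (u == x); rewrite /= ?orbT ?orbA.
  rewrite (@eq_ndistinct _ (b ++ edges x w2)
    (edge x y :: edges y w1 ++ edge x z :: edges x w2)); last first.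
    by move=> u; rewrite /b !(inE, mem_cat) -/(edges _ _); congr (_ || _); rewrite orbCA.
  have xyNb : edge x y \notin edge x z :: edges y w1.
    by rewrite inE negb_or (inj_eq (@edge_inj x)) eq_sym zy xNw1.
  have xzNb : edge x z \notin edges y w1 by rewrite xNw1.
  rewrite /a /b (ndistinct_cons x (y :: w1)) xNq.
  rewrite (ndistinct_cons (edge x y) (_ :: edges y w1)) xyNb.
  rewrite (ndistinct_cons (edge x z) (edges y w1)) xzNb.
  by rewrite [nat_of_bool true]/=; lia.
rewrite zy in edgesE p2 nE.
have xyNw2 : edge x y \notin edges x w2.
  have := p2 _ (mem_head _ _); rewrite /= count_cat /= eqxx.
  rewrite (count_memPn (xNw1 y)) add0n !add1n => -[].
  by move/count_memPn.
have dis : ~~ has (mem (x :: w2)) (y :: w1).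
  apply/hasPn => v vw1; apply/negP; rewrite inE => /predU1P[vx|vw2].
    by rewrite -vx vw1 in xNq.
  have vx : v != x by apply: contraNneq xNq => <-.
  have [p1 [q2 w2E]] : exists p1 q2 : seq 'I_N, w2 = p1 ++ v :: q2.
    by case/splitPr: vw2 => p1 q2; exists p1, q2.
  rewrite {vw2}w2E in px p2 xyNw2 pV nE edgesE.
  rewrite last_cat /= in px.
  have xq2 : x \in q2.
    by have := mem_last v q2; rewrite px inE eq_sym (negPf vx).
  have leV := ndistinct_walk y w1.
  have ba u u' : edge u u' \in edges y w1 -> u \in y :: w1 by exact: edges_end.
  have le1 := ndistinct_extend_walk q2 vw1 ba.
  have ba' u u' : edge u u' \in edges y w1 ++ edges v q2 ->
      u \in (y :: w1) ++ q2.
    rewrite !mem_cat => /orP[/edges_end->//|/edges_end].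
    by rewrite in_cons => /predU1P[->|->]; rewrite ?vw1 ?orbT.
  have xa' : x \in (y :: w1) ++ q2 by rewrite mem_cat xq2 orbT.
  have le2 := ndistinct_extend_walk p1 xa' ba'.
  have leVa : (ndistinct (x :: (y :: w1) ++ x :: p1 ++ v :: q2) <=
      ndistinct (((y :: w1) ++ q2) ++ p1))%N.
    apply: sub_ndistinct => u; rewrite in_cons.
    case/predU1P => [->|]; first by rewrite !mem_cat xq2 orbT.
    rewrite mem_cat => /orP[uw|]; first by rewrite !mem_cat uw.
    rewrite in_cons => /predU1P[->|]; first by rewrite !mem_cat xq2 orbT.
    rewrite mem_cat => /orP[up|]; first by rewrite !mem_cat up orbT.
    rewrite in_cons => /predU1P[->|uq]; first by rewrite !mem_cat vw1.
    by rewrite !mem_cat uq orbT.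
  have leE : (ndistinct ((edges y w1 ++ edges v q2) ++ edges x p1) <=
      ndistinct (edges y w1 ++ edges x (p1 ++ v :: q2)))%N.
    apply: sub_ndistinct => e; rewrite edges_cat /= !(mem_cat, inE).
    by case/orP => [/orP[]|] ->; rewrite ?orbT.
  have nE' : ndistinct (edge x y :: edges y w1 ++ edge x y :: edges x (p1 ++ v :: q2)) =
      (ndistinct (edges y w1 ++ edges x (p1 ++ v :: q2))).+1.
    rewrite -add1n (@eq_ndistinct _ _
      (edge x y :: edges y w1 ++ edges x (p1 ++ v :: q2))).
      by rewrite ndistinct_cons mem_cat negb_or xNw1 xyNw2.
    by move=> e; rewrite !(inE, mem_cat); case: (e == _); rewrite /= ?orbT.
  rewrite nE' in nE.
  have arith (V V' a a' b b' c E s : nat) : (V' + b' <= c + a')%N ->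
      (a' + b <= b' + a)%N -> (a <= b.+1)%N -> (V <= V')%N -> (c <= E)%N ->
      V.*2 = s.+2 -> E.+1.*2 = s -> False by lia.
  exact: arith le2 le1 leV leVa leE pV nE.
have p2' e : e \in edges y w1 ++ edges x w2 ->
    (count_mem e (edges y w1) + count_mem e (edges x w2))%N = 2%N.
  move=> ew; rewrite -(p2 e); last first.
    by move: ew; rewrite !(inE, mem_cat) => /orP[]->; rewrite !orbT.
  rewrite /= count_cat /=; have -> : edge x y == e = false; last by lia.
  apply: contraTF ew => /eqP <-; rewrite mem_cat negb_or xNw1.
  exact: xyNw2.
have w1_2 e : e \in edges y w1 -> count_mem e (edges y w1) = 2%N.
  move=> ew; have := p2' e; rewrite mem_cat ew => /(_ isT).
  by rewrite (count_memPn (edges_disjoint dis ew)) addn0.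
have dis' : ~~ has (mem (y :: w1)) (x :: w2) by rewrite has_sym.
have w2_2 e : e \in edges x w2 -> count_mem e (edges x w2) = 2%N.
  move=> ew; have := p2' e; rewrite mem_cat ew orbT => /(_ isT).
  by rewrite (count_memPn (edges_disjoint dis' ew)) add0n.
exists y, w1, w2.
have := ndistinct_count_eq2 w1_2; have := ndistinct_count_eq2 w2_2.
rewrite !size_edges => nE2 nE1.
have leV1 := ndistinct_walk y w1; have leV2 := ndistinct_walk x w2.
move: pV; rewrite (@eq_ndistinct _ _ ((y :: w1) ++ x :: w2)); last first.
  by move=> u; rewrite !(inE, mem_cat); case: (u == x); rewrite /= ?orbT ?orbA.
rewrite ndistinct_disjoint_cat// size_cat /= => pV.
by split=> //; apply/tree_walkP; split=> //; lia.
Qed.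

(** Converse of the cut at the first return; the exact sum over tree walks needs the cut to be a
    bijection. *)
Lemma tree_walk_cat x y w1 w2 : tree_walk y w1 -> tree_walk x w2 ->
  ~~ has (mem (x :: w2)) (y :: w1) -> tree_walk x (y :: w1 ++ x :: w2).
Proof.
move=> /tree_walkP[w1y w1_2 V1] /tree_walkP[w2x w2_2 V2] dis.
have dis' : ~~ has (mem (y :: w1)) (x :: w2) by rewrite has_sym.
have xNw1 u : edge x u \notin edges y w1.
  apply: contra dis => /edges_end xw1.
  by apply/hasP; exists x => //; exact: mem_head.
have yNw2 u : edge y u \notin edges x w2.
  apply: contra dis => /edges_end yw2.
  by apply/hasP; exists y => //; exact: mem_head.
apply/tree_walkP; split.
- by rewrite /= last_cat.
- move=> e; rewrite /= edges_cat w1y /= [edge y x]edgeC => ep.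
  rewrite count_cat /=; have [<-|xye] /= := eqVneq (edge x y) e.
    rewrite (count_memPn (xNw1 _)) edgeC (count_memPn (yNw2 _)).
    by [].
  have : (e \in edges y w1) || (e \in edges x w2).
    move: ep; rewrite !(inE, mem_cat) eq_sym (negPf xye).
    by [].
  case/orP => ew; first by rewrite w1_2// (count_memPn (edges_disjoint dis ew)).
  by rewrite w2_2// (count_memPn (edges_disjoint dis' ew)).
rewrite (@eq_ndistinct _ _ ((y :: w1) ++ x :: w2)); last first.
  by move=> u; rewrite !(inE, mem_cat); case: (u == x); rewrite /= ?orbT ?orbA.
by rewrite ndistinct_disjoint_cat// doubleD V1 V2 /= size_cat /= !addSn !addnS.
Qed.

End walks.

(** * Sums over words *)

Section words.
Variables (N : nat) (R : nmodType).
Implicit Types (f : seq 'I_N -> R).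

(** Plain sequences rather than tuples: words are constantly cut and concatenated, and no cast
    between lengths is then needed. *)
Fixpoint words (L : nat) : seq (seq 'I_N) :=
  if L is L'.+1 then [seq v :: p | v <- enum 'I_N, p <- words L'] else [:: [::]].

Lemma size_words L p : p \in words L -> size p = L.
Proof.
elim: L p => [|L IH] p /=; first by rewrite inE => /eqP ->.
by case/allpairsP => -[v q] /= [_ /IH sq ->]; rewrite /= sq.
Qed.

Lemma sum_words0 f : \sum_(p <- words 0) f p = f [::].
Proof. exact: big_seq1. Qed.

Lemma sum_wordsS L f :
  \sum_(p <- words L.+1) f p = \sum_v \sum_(p <- words L) f (v :: p).
Proof. by rewrite /= big_allpairs_dep big_enum. Qed.

Lemma sum_wordsD K L f :
  \sum_(p <- words (K + L)) f p =
  \sum_(p <- words K) \sum_(q <- words L) f (p ++ q).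
Proof.
elim: K f => [|K IH] f; first by rewrite sum_words0.
by rewrite addSn !sum_wordsS; apply: eq_bigr => v _; rewrite IH.
Qed.

End words.

(** * Weights of walks and their factorization at the first return *)

Section walk_weights.
Variables (N : nat) (R : comNzRingType).
Implicit Types (u v x y : 'I_N) (p : seq 'I_N) (e : 'I_N * 'I_N) (s t : nat).

(** The time is kept with the edge because the matrices of different times differ: the moment at an
    edge depends on when it is traversed. *)
Fixpoint steps s x p : seq ('I_N * 'I_N * nat) :=
  if p is v :: q then (edge x v, s) :: steps s.+1 v q else [::].

Definition times_of e (st : seq ('I_N * 'I_N * nat)) : seq nat :=
  [seq z.2 | z <- st & z.1 == e].

Lemma map_fst_steps s x p : map fst (steps s x p) = edges x p.
Proof. by elim: p s x => //= v p IH s x; rewrite IH. Qed.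

Lemma size_times_of e s x p :
  size (times_of e (steps s x p)) = count_mem e (edges x p).
Proof. by rewrite size_map size_filter -(map_fst_steps s) count_map. Qed.

Lemma times_of_eq0 e s x p :
  e \notin edges x p -> times_of e (steps s x p) = [::].
Proof.
move=> ep; apply/nilP; rewrite /nilp size_times_of.
by rewrite (count_memPn ep).
Qed.

Lemma times_of_cat e st1 st2 :
  times_of e (st1 ++ st2) = times_of e st1 ++ times_of e st2.
Proof. by rewrite /times_of filter_cat map_cat. Qed.

Lemma steps_cat s x p q :
  steps s x (p ++ q) = steps s x p ++ steps (s + size p) (last x p) q.
Proof.
by elim: p s x => [|v p IH] s x /=; rewrite ?addn0// IH addSnnS.
Qed.

Variables (M : 'I_N * 'I_N -> seq nat -> R) (m : nat -> R).
Hypothesis M_nil : forall e, M e [::] = 1.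
Hypothesis m0 : m 0 = 1.

Definition edge_weight (st : seq ('I_N * 'I_N * nat)) : R :=
  \prod_e M e (times_of e st).

Definition vertex_weight p : R := \prod_v m (count_mem v p).

Lemma vertex_weight_perm p q : perm_eq p q -> vertex_weight p = vertex_weight q.
Proof.
by move=> /permP pq; apply: eq_bigr => v _; rewrite pq.
Qed.

Lemma vertex_weight_cat p q : ~~ has (mem q) p ->
  vertex_weight (p ++ q) = vertex_weight p * vertex_weight q.
Proof.
move=> /hasPn dis; rewrite -big_split; apply: eq_bigr => v _ /=.
rewrite count_cat; case: (boolP (v \in p)) => [/dis/= vq|vp].
  by rewrite (count_memPn vq) addn0 m0 mulr1.
by rewrite (count_memPn vp) add0n m0 mul1r.
Qed.

Lemma vertex_weight_nseq n x : vertex_weight (nseq n x) = m n.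
Proof.
rewrite /vertex_weight (bigD1 x)//= count_nseq /= eqxx mul1n.
rewrite big1 ?mulr1// => v vx.
by rewrite count_nseq /= eq_sym (negPf vx) mul0n.
Qed.

(** [j] stands for earlier visits to the root and [s] for the time of the first step, so that the
    rest of a walk after an excursion is again of this form. *)
Definition walk_weight (j s : nat) x p : R :=
  vertex_weight (nseq j x ++ x :: p) * edge_weight (steps s x p).

Variable W : nat -> R.
Hypothesis M_pair : forall x y s t, x != y -> (0 < s)%N -> (s < t)%N ->
  M (edge x y) [:: s; t] = W (t - s)%N.

(** Disjoint vertex sets share no edge, so both products split. The edge between [x] and [y] is
    traversed at the times [s] and [s + size w1 + 1], and the initial visit to [x] is passed on to
    the rest of the walk as [j.+1]. *)
Lemma walk_weight_first_return j s x y w1 w2 : (0 < s)%N ->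
  last y w1 = y -> ~~ has (mem (x :: w2)) (y :: w1) ->
  walk_weight j s x (y :: w1 ++ x :: w2) =
  W (size w1).+1 * walk_weight 0 s.+1 y w1 *
    walk_weight j.+1 (s + size w1).+2 x w2.
Proof.
move=> s0 w1y dis; rewrite /walk_weight.
have dis' : ~~ has (mem (y :: w1)) (x :: w2) by rewrite has_sym.
have xNw1 u : edge x u \notin edges y w1.
  apply: contra dis => /edges_end xw1.
  by apply/hasP; exists x => //; exact: mem_head.
have yNw2 u : edge y u \notin edges x w2.
  apply: contra dis => /edges_end yw2.
  by apply/hasP; exists y => //; exact: mem_head.
have xy : x != y.
  by apply: contraNneq dis => ->; rewrite /= inE eqxx.
have -> : vertex_weight (nseq j x ++ x :: y :: w1 ++ x :: w2) =
    vertex_weight (nseq 0 y ++ y :: w1) *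
    vertex_weight (nseq j.+1 x ++ x :: w2).
  rewrite -vertex_weight_cat; last first.
    rewrite has_sym; apply/hasPn => v; rewrite mem_cat mem_nseq.
    by case/orP => [/andP[_ /eqP ->]|]; apply: (hasPn dis'); rewrite mem_head.
  apply: vertex_weight_perm; rewrite perm_sym.
  apply/permP => P; rewrite !(count_cat, count_nseq) /=.
  by rewrite !count_cat /=; lia.
have -> : edge_weight (steps s x (y :: w1 ++ x :: w2)) =
    W (size w1).+1 * edge_weight (steps s.+1 y w1) *
    edge_weight (steps (s + size w1).+2 x w2).
  rewrite /= steps_cat w1y /= addSn [edge y x]edgeC.
  rewrite /edge_weight (bigD1 (edge x y))//=.
  rewrite [X in _ = _ * X * _](bigD1 (edge x y))//=.
  rewrite [X in _ = _ * X](bigD1 (edge x y))//=.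
  have -> : times_of (edge x y) (steps s.+1 y w1) = [::] by exact: times_of_eq0.
  have xyNw2 : times_of (edge x y) (steps (s + size w1).+2 x w2) = [::].
    by apply: times_of_eq0; rewrite edgeC.
  rewrite xyNw2 !M_nil !mul1r -mulrA -big_split; congr (_ * _).
    rewrite -cat1s !times_of_cat -[_ :: steps _ x _]cat1s times_of_cat xyNw2.
    rewrite [times_of (edge x y) (steps s.+1 y w1)]times_of_eq0//.
    rewrite /times_of /= !eqxx /= M_pair//; last by lia.
    by congr W; lia.
  apply: eq_bigr => e exy /=.
  rewrite -cat1s !times_of_cat -[_ :: steps _ x _]cat1s times_of_cat.
  rewrite {1 3}/times_of /= eq_sym (negPf exy) /=.
  case: (boolP (e \in edges y w1)) => ew.
    by rewrite (times_of_eq0 _ (edges_disjoint dis ew)) cats0 M_nil mulr1.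
  by rewrite (times_of_eq0 _ ew) M_nil mul1r.
by ring.
Qed.

(** The condition on [index] puts the first return to [x] just after [w1]; without it a walk that
    returns several times could be cut in several places. *)
Lemma tree_walk_split x y x' w1 w2 :
  tree_walk x (y :: w1 ++ x' :: w2) &&
    (index x (y :: w1 ++ x' :: w2) == (size w1).+1) =
  [&& x' == x, tree_walk y w1, tree_walk x w2 &
      ~~ has (mem (x :: w2)) (y :: w1)].
Proof.
have cat_inj (a b a' b' : seq 'I_N) : size a = size a' ->
    a ++ x :: b = a' ++ x :: b' -> a = a' /\ b = b'.
  by move=> sa /eqP; rewrite eqseq_cat// eqseq_cons eqxx => /andP[/eqP-> /eqP->].
apply/andP/and4P => [[tw /eqP ix]|[/eqP -> tw1 tw2 dis]]; last first.
  split; first exact: tree_walk_cat.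
  have xNw1 : x \notin y :: w1.
    by apply: contra dis => xw1; apply/hasP; exists x => //; exact: mem_head.
  by rewrite -cat_cons index_cat (negPf xNw1) /= eqxx addn0.
have [y0 [w1' [w2' [pE xNq tw1 tw2 dis]]]] := tree_walk_first_return tw isT.
move: pE ix; rewrite -!cat_cons => pE; rewrite pE index_cat (negPf xNq).
rewrite /= eqxx addn0 => -[sw1].
have : (y :: w1) ++ x' :: w2 == (y0 :: w1') ++ x :: w2' by apply/eqP.
rewrite eqseq_cat; last by rewrite /= sw1.
rewrite !eqseq_cons.
move=> /andP[/andP[/eqP-> /eqP->] /andP[/eqP-> /eqP->]].
by split.
Qed.

(** Confining the walk to [S] turns the disjointness of the two pieces into separate conditions on
    each: the rest of the walk is confined to what the excursion leaves of [S]. *)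
Definition tree_walk_in (S : {set 'I_N}) x p :=
  tree_walk x p && all [pred v | (v == x) || (v \in S)] p.

Lemma tree_walk_in_split (S : {set 'I_N}) x y x' w1 w2 : x \notin S ->
  tree_walk_in S x (y :: w1 ++ x' :: w2) &&
    (index x (y :: w1 ++ x' :: w2) == (size w1).+1) =
  [&& x' == x, y \in S, tree_walk_in (S :\ y)%SET y w1 &
      tree_walk_in (S :\: [set:: y :: w1])%SET x w2].
Proof.
move=> xS; rewrite /tree_walk_in -andbA [all _ _ && _]andbC andbA.
rewrite tree_walk_split.
case: eqVneq => [->|_]; last by [].
case tw1: (tree_walk y w1); last by rewrite /= !andbF.
case tw2: (tree_walk x w2); last by rewrite /= !andbF.
rewrite !andTb.
apply/andP/and3P => [[dis allp]|[yS allw1 allw2]].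
  have xNw1 : x \notin y :: w1.
    by apply: contra dis => xw1; apply/hasP; exists x => //; exact: mem_head.
  have memS v : v \in y :: w1 -> v \in S.
    move=> vw1; have : v != x by apply: contraNneq xNw1 => <-.
    move/negPf=> vx; move/allP: allp => /(_ v); rewrite /= vx; apply.
    by rewrite -cat_cons mem_cat vw1.
  split; first by rewrite memS ?mem_head.
    apply/allP => v vw1; rewrite !inE /=; case: eqVneq => //= _.
    by rewrite memS// inE vw1 orbT.
  apply/allP => v vw2; rewrite !inE /=; case: eqVneq => //= vx.
  rewrite -in_cons; apply/andP; split.
    apply: contra dis => vw1; apply/hasP; exists v => //.
    exact: (@mem_behead _ (x :: w2)).
  move/allP: allp => /(_ v); rewrite /= (negPf vx); apply.
  by rewrite -cat_cons mem_cat [v \in x :: w2]in_cons vw2 !orbT.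
have memS v : v \in y :: w1 -> v \in S.
  rewrite inE => /predU1P[->//|vw1]; move/allP: allw1 => /(_ _ vw1).
  by rewrite /= !inE => /predU1P[->//|/andP[]].
split.
  apply/hasPn => v vw1; rewrite /= inE negb_or.
  apply/andP; split; first by apply: contraNneq xS => <-; exact: memS.
  apply/negP => vw2; move/allP: allw2 => /(_ _ vw2).
  rewrite /= !inE -in_cons vw1 /= orbF => /eqP vx.
  by move: xS; rewrite -vx memS.
apply/allP => v; rewrite -cat_cons mem_cat => /orP[/memS vS|].
  by rewrite /= vS orbT.
rewrite inE => /predU1P[->|vw2]; first by rewrite /= eqxx.
move/allP: allw2 => /(_ _ vw2); rewrite /= !inE.
by case/predU1P => [->|/andP[_ ->]]; rewrite ?eqxx ?orbT.
Qed.

End walk_weights.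

(** Choosing [k + l] distinct vertices in order: [k] of them for the excursion, then [l] among those
    left. *)
Lemma ffactnD n k l : (n ^_ (k + l) = n ^_ k * (n - k) ^_ l)%N.
Proof.
elim: k n => [|k IH] n; first by rewrite ffactn0 mul1n subn0.
by rewrite addSn !ffactnS IH mulnA; congr (_ * _ ^_ _)%N; lia.
Qed.

(** * The exact sum over tree walks *)

Section sum_tree_walks.
Variables (N : nat) (R : comNzRingType).
Implicit Types (x y : 'I_N) (p : seq 'I_N).
Variables (M : 'I_N * 'I_N -> seq nat -> R) (m : nat -> R) (W : nat -> R).
Hypothesis M_nil : forall e, M e [::] = 1.
Hypothesis m0 : m 0 = 1.
Hypothesis M_pair : forall x y s t, x != y -> (0 < s)%N -> (s < t)%N ->
  M (edge x y) [:: s; t] = W (t - s)%N.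
Variable E : nat -> nat -> R.
Hypothesis E0 : forall j, E j 0 = m j.+1.
Hypothesis ES : forall j n, E j n.+1 =
  \sum_(a < n.+1) W a.*2.+1 * E 0 a * E j.+1 (n - a)%N.

Local Notation weight := (walk_weight M m).

Lemma tree_walk_index x p n : tree_walk x p -> size p = n.+1.*2 ->
  exists2 a, (a <= n)%N & index x p = a.*2.+1.
Proof.
move=> tw sp; have p0 : p != [::] by rewrite -size_eq0 sp.
have [y [w1 [w2 [pE xNq /tree_walkP[_ _ sw1] _ _]]]] := tree_walk_first_return tw p0.
(* The excursion is itself a tree walk, so its length is twice its number of vertices minus one; the
   steps to [y] and back make the index odd. *)
exists (ndistinct (y :: w1)).-1.
  by move: sp sw1; rewrite pE /= size_cat /=; lia.
rewrite pE -cat_cons index_cat (negPf xNq) /= eqxx addn0.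
by congr _.+1; lia.
Qed.

Lemma card_setD_walk (S : {set 'I_N}) y w1 a : y \in S -> size w1 = a.*2 ->
  tree_walk_in (S :\ y)%SET y w1 -> #|(S :\: [set:: y :: w1])%SET| = (#|S| - a.+1)%N.
Proof.
move=> yS sw1 /andP[/tree_walkP[_ _ nw1] /allP allw1].
rewrite cardsD; congr (_ - _)%N.
have -> : #|(S :&: [set:: y :: w1])%SET| = ndistinct (y :: w1).
  rewrite /ndistinct -(card_uniqP (undup_uniq (y :: w1))).
  apply: eq_card => v; rewrite !inE -in_cons mem_undup in_cons.
  case: eqVneq => [->|vy] /=; first by rewrite yS.
  case: (boolP (v \in w1)) => [/allw1|_]; last by rewrite andbF.
  by rewrite /= !inE (negPf vy) => /= ->.
by lia.
Qed.

Lemma tree_walk_nil x : tree_walk x [::].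
Proof. by rewrite /tree_walk eqxx. Qed.

(** The weight of a tree walk depends neither on which vertices it visits nor on its start time, so
    the labels contribute only the number of ordered choices of [n] distinct vertices in [S]. The
    induction is strong and leaves [j], [s], [x] and [S] free, since the two pieces of a cut change
    all of them. *)
Lemma sum_tree_walks n j s x (S : {set 'I_N}) : (0 < s)%N -> x \notin S ->
  \sum_(p <- words N n.*2 | tree_walk_in S x p) weight j s x p =
  (#|S| ^_ n)%:R * E j n.
Proof.
have [k] := ubnP n; elim: k n j s x S => // k IH [|n] j s x S.
  move=> _ _ _; rewrite big_cons big_nil /tree_walk_in tree_walk_nil /= addr0.
  rewrite ffactn0 mul1r E0 /walk_weight /edge_weight /=.
  rewrite [X in _ * X]big1 ?mulr1 => [|e _]; last by rewrite M_nil.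
  rewrite -(vertex_weight_nseq m0 j.+1 x); apply: vertex_weight_perm.
  by rewrite perm_catC.
rewrite ltnS => nk s0 xS.
(* The first return has index [a.*2.+1] with [a <= n]; its half [a] labels the terms of [ES]. *)
rewrite (partition_big (fun p => inord (index x p)./2 : 'I_n.+1) predT)//=.
rewrite ES mulr_sumr; apply: eq_bigr => a _.
have an : (a <= n)%N by rewrite -ltnS.
transitivity (\sum_(p <- words N (1 + (a.*2 + (1 + (n - a).*2))))
    if tree_walk_in S x p && (index x p == a.*2.+1) then weight j s x p else 0).
  have -> : (1 + (a.*2 + (1 + (n - a).*2)))%N = n.+1.*2 by lia.
  rewrite -big_mkcond big_seq_cond [RHS]big_seq_cond; apply: eq_bigl => p.
  case: (boolP (p \in words N _)) => // /size_words sp; rewrite !andTb.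
  case: (boolP (tree_walk_in S x p)) => //= /andP[tw _].
  have [b bn ->] := tree_walk_index tw sp.
  rewrite -[b.*2.+1]/(true + b.*2)%N half_bit_double eqSS.
  apply/eqP/eqP => [<-|/double_inj ->]; first by rewrite inordK.
  by apply/val_inj; rewrite /= inordK.
rewrite sum_wordsS.
(* [tree_walk_in_split] leaves only [x' = x], and the sum over [w2] is given by the induction
   hypothesis, with the [a.+1] vertices of the excursion removed from [S]. *)
transitivity (\sum_(y in S)
  \sum_(w1 <- words N a.*2 | tree_walk_in (S :\ y)%SET y w1)
  (W a.*2.+1 * weight 0 s.+1 y w1 *
    (((#|S| - a.+1) ^_ (n - a))%:R * E j.+1 (n - a)%N))).
  rewrite [RHS]big_mkcond; apply: eq_bigr => y _; rewrite sum_wordsD.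
  case: (boolP (y \in S)) => yS; last first.
    rewrite big_seq big1 // => w1 /size_words sw1; rewrite sum_wordsS big1 // => x' _.
    by rewrite big1// => w2 _; rewrite -sw1 tree_walk_in_split// (negPf yS) andbF.
  rewrite [RHS]big_mkcond big_seq [RHS]big_seq; apply: eq_bigr => w1 /size_words sw1.
  rewrite sum_wordsS (bigD1 x)//= [X in _ + X]big1 ?addr0 => [|x' x'x]; last first.
    by rewrite big1// => w2 _; rewrite -sw1 tree_walk_in_split// (negPf x'x).
  under eq_bigr => w2 _ do rewrite -sw1 tree_walk_in_split// eqxx yS /=.
  rewrite -sw1; case: ifPn => tw1; last by rewrite big1.
  rewrite -big_mkcond /=.
  rewrite (eq_bigr (fun w2 => W (size w1).+1 * weight 0 s.+1 y w1 *
    weight j.+1 (s + size w1).+2 x w2)) => [|w2 tw2]; last first.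
    apply: (walk_weight_first_return M_nil m0 M_pair _ s0).
      by case/andP: tw1 => /tree_walkP[].
    have := tree_walk_in_split y x w1 w2 xS.
    rewrite eqxx yS tw1 tw2 /= => /andP[/andP[tw _] ix].
    have := tree_walk_split x y x w1 w2; rewrite tw ix => /esym/and4P[_ _ _].
    by [].
  rewrite -big_distrr /= IH//; last 2 first.
  - by rewrite ltnNge; apply: contraL nk; lia.
  - apply: contra xS; by rewrite !inE => /andP[].
  by rewrite (card_setD_walk yS sw1 tw1) sw1.
transitivity (\sum_(y in S) W a.*2.+1 * (((#|S|.-1) ^_ a)%:R * E 0 a) *
    (((#|S| - a.+1) ^_ (n - a))%:R * E j.+1 (n - a)%N)).
  apply: eq_bigr => y yS; rewrite -big_distrl -big_distrr /= IH//.
  - by rewrite (cardsD1 y S) yS.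
  - by lia.
  - by rewrite !inE eqxx.
rewrite sumr_const -mulr_natl.
have -> : (#|S| ^_ n.+1 = #|S| * (#|S|.-1 ^_ a * (#|S| - a.+1) ^_ (n - a)))%N.
  rewrite ffactnS -[X in (_ * _ ^_ X)%N = _](subnKC an) ffactnD.
  by congr (_ * (_ * _ ^_ _))%N; lia.
by rewrite !natrM; ring.
Qed.

End sum_tree_walks.

(** A letter put in front of a word of length [K] either repeats one of at most [K] letters, or is
    one of at most N new ones and lowers the allowance [d] by one. The recursion (K + 1)! = K K! +
    K! absorbs both cases. *)
Lemma count_words_few_letters (N K d : nat) : (0 < N)%N ->
  (\sum_(p <- words N K | (ndistinct p <= d)%N) 1 <= K`! * N ^ d)%N.
Proof.
move=> N0; elim: K d => [|K IH] d.
  rewrite big_mkcond big_seq1 /=.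
  by rewrite fact0 mul1n expn_gt0 N0.
rewrite big_mkcond big_allpairs_dep big_enum exchange_big /=.
(* The factor [0 < d] excludes a new letter when [d = 0], where [d.-1] would still be 0. *)
apply: (@leq_trans (\sum_(p <- words N K)
    ((ndistinct p <= d) * K + (0 < d) * (ndistinct p <= d.-1) * N))%N).
  rewrite big_seq [leqRHS]big_seq; apply: leq_sum => p /size_words sp.
  apply: (@leq_trans (\sum_(v : 'I_N) ((ndistinct p <= d) * (v \in p) +
      (0 < d) * (ndistinct p <= d.-1)))%N).
    apply: leq_sum => v _; rewrite ndistinct_cons.
    case: (v \in p) => /=.
      by rewrite add0n muln1; case: (_ <= d)%N; rewrite ?leq_addr.
    rewrite add1n muln0 add0n; case: d => // d; rewrite ltnS mul1n /=.
    by case: (_ <= d)%N.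
  rewrite big_split /= sum_nat_const card_ord -big_distrr /=.
  apply: leq_add; last by rewrite [leqRHS]mulnC.
  rewrite leq_mul2l; apply/orP; right.
  rewrite -sp (leq_trans _ (card_size p))// -sum1_card [leqRHS]big_mkcond.
  by apply: leq_sum => v _; case: (v \in p).
rewrite big_split /= -!big_distrl /= factS mulSn mulnDl.
have sumE d' : (\sum_(p <- words N K) (ndistinct p <= d') =
    \sum_(p <- words N K | ndistinct p <= d') 1)%N.
  by rewrite [RHS]big_mkcond; apply: eq_bigr => p _; case: (_ <= _)%N.
rewrite addnC; apply: leq_add; last first.
  by rewrite sumE -mulnA [leqLHS]mulnC leq_mul2l IH orbT.
case: d => [|d] /=; first by rewrite big1.
under eq_bigr do rewrite mul1n.
by rewrite sumE mulnC expnS mulnCA leq_mul2l IH orbT.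
Qed.

(** * Expansion of the trace over closed walks *)

Section trace_expansion.
Variables (N : nat) (R : comNzRingType).
Implicit Types (x y : 'I_N) (p : seq 'I_N).
Variables (Gam : nat -> 'M[R]_N) (g : 'I_N * 'I_N * nat -> R) (a : 'I_N -> R).
Hypothesis Gam_edge : forall k x y, (0 < k)%N -> Gam k x y = g (edge x y, k).

Local Notation D := (diag_mx (\row_j a j)).

Lemma prod_mx_words s k x y : (0 < s)%N ->
  (\prod_(m <- iota s k) (Gam m *m D)) x y =
  \sum_(p <- words N k | last x p == y)
    (\prod_(z <- steps s x p) g z * \prod_(v <- p) a v).
Proof.
elim: k s x => [|k IH] s x s0.
  rewrite big_nil [RHS]big_mkcond sum_words0 /= !big_nil mulr1.
  by rewrite [LHS](@mxE R N N) mulrb.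
rewrite big_cons /= -mulmxE mxE [RHS]big_mkcond sum_wordsS.
apply: eq_bigr => v _; rewrite IH// mul_mx_diag !mxE Gam_edge//.
rewrite mulr_sumr -big_mkcond; apply: eq_bigr => p _ /=.
by rewrite !big_cons /=; ring.
Qed.

Lemma trace_walks k :
  \tr (D *m \prod_(1 <= m < k.+1) (Gam m *m D)) =
  \sum_x \sum_(p <- words N k | last x p == x)
    (\prod_(v <- x :: p) a v * \prod_(z <- steps 1 x p) g z).
Proof.
apply: eq_bigr => x _; rewrite /index_iota subn1 mul_diag_mx !mxE.
rewrite prod_mx_words// mulr_sumr; apply: eq_bigr => p _.
by rewrite big_cons; ring.
Qed.

End trace_expansion.

(** * Plane trees and formal power series *)

(** Passes from finitely supported sums over sets of trees to the indexed sums that give the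
    coefficients of power series. *)
Lemma fsumr_partition (R : zmodType) (I : choiceType) (A : set I) (F : I -> R)
    (k : I -> nat) (n : nat) :
  finite_set A -> (forall x, A x -> (k x <= n)%N) ->
  \sum_(x \in A) F x =
    \sum_(i < n.+1) \sum_(x \in A `&` [set x | k x = i]) F x.
Proof.
move=> finA kn; rewrite fsbig_finite// [LHS]big_seq.
rewrite (partition_big (fun x => inord (k x) : 'I_n.+1) predT)//=.
apply: eq_bigr => i _; rewrite fsbig_mkcondr fsbig_finite// -big_mkcond/=.
rewrite [RHS]big_seq_cond; apply: eq_bigl => x; case: (boolP (x \in _)) => //=.
rewrite in_fset_set// inE => /kn kxn; apply/eqP/idP.
  by move=> <-; rewrite inE /= inordK.
by rewrite inE /= => kxi; apply/val_inj; rewrite /= inordK.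
Qed.

Section plane_forests.
Variables (R : realType) (f : ptree -> R).

Definition forests (k n : nat) : set (seq ptree) :=
  [set s | size s = k /\ sumn [seq nodes u | u <- s] = n].

Lemma finite_forests k n : finite_set (forests k n).
Proof.
apply: sub_finite_set (finite_image children (finite_plane_trees n.+1)).
by move=> s [_ sn]; exists (PNode s) => //; rewrite /plane_trees/= sn.
Qed.

Lemma nodes_gt0 t : (0 < nodes t)%N. Proof. by case: t. Qed.

Lemma size_le_sumn_nodes s : (size s <= sumn [seq nodes u | u <- s])%N.
Proof. by elim: s => //= t s IH; have := nodes_gt0 t; lia. Qed.

Definition tree_sum (n : nat) : R := \sum_(t \in plane_trees n) f t.

Definition forest_sum (k n : nat) : R :=
  \sum_(s \in forests k n) \prod_(u <- s) f u.

Lemma forest_sum0 n : forest_sum 0 n = (n == 0)%:R.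
Proof.
case: n => [|n].
  rewrite /forest_sum (_ : forests 0 0 = [set [::]]) ?fsbig_set1 ?big_nil//.
  by apply/seteqP; split=> [s [/size0nil]|s ->].
rewrite /forest_sum (_ : forests 0 n.+1 = set0) ?fsbig_set0//.
by apply/seteqP; split=> s // [/size0nil ->].
Qed.

Lemma forest_sumS k n : forest_sum k.+1 n =
  \sum_(i < n.+1) tree_sum i * forest_sum k (n - i).
Proof.
(* The forests considered have [k.+1] trees, so the default of [head] never occurs. *)
pose hd s := nodes (head (PNode [::]) s).
rewrite /forest_sum (@fsumr_partition _ _ _ _ hd n); first last.
- by case=> [|t s] [//= _ <-]; rewrite leq_addr.
- exact: finite_forests.
apply: eq_bigr => i _; rewrite /tree_sum mulr_fsuml.
under [RHS]eq_fsbigr do rewrite mulr_fsumr.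
rewrite pair_fsbig; [|exact: finite_plane_trees|exact: finite_forests].
rewrite (@reindex_fsbig _ _ _ _ _ (fun p : ptree * seq ptree => p.1 :: p.2)
  (plane_trees i `*` forests k (n - i))).
  by apply: eq_fsbigr => p _; rewrite big_cons.
have in_ord := ltn_ord i; split.
- move=> [t s] [/= ti [sk sn]]; rewrite /hd /forests /= ti sk sn.
  by split=> //; split=> //; lia.
- by move=> [t s] [t' s'] _ _ /= [-> ->].
- case=> [|t s] [[//= [sk] sn] ti]; exists (t, s) => //.
  by split=> //; split=> //=; move: sn ti; rewrite /hd /=; lia.
Qed.

Lemma forest_sum_exp k n : forest_sum k n = fps_exp tree_sum k n.
Proof.
elim: k n => [|k IH] n; first by rewrite forest_sum0.
by rewrite forest_sumS /=; apply: eq_bigr => i _; rewrite IH.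
Qed.

(** Deleting the root leaves a forest with [n] nodes; each of its trees has a node, so the outdegree
    of the root is at most [n]. *)
Lemma tree_sum_root (g : nat -> R) (n : nat) :
  \sum_(t \in plane_trees n.+1)
    g (size (children t)) * \prod_(u <- children t) f u =
  \sum_(k < n.+1) g k * forest_sum k n.
Proof.
pose A : set (seq ptree) := [set s | sumn [seq nodes u | u <- s] = n].
have finA : finite_set A.
  apply: sub_finite_set (finite_image children (finite_plane_trees n.+1)).
  by move=> s sn; exists (PNode s) => //; rewrite /plane_trees/= sn.
rewrite (@reindex_fsbig _ _ _ _ _ PNode A); last first.
  split; first by move=> s sn; rewrite /plane_trees /= sn.
  - by move=> s s' _ _ [].
  - by case=> s /= [sn]; exists s.
rewrite (@fsumr_partition _ _ _ _ size n)//; last first.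
  by move=> s <-; exact: size_le_sumn_nodes.
apply: eq_bigr => k _; rewrite /forest_sum mulr_fsumr.
rewrite (_ : A `&` _ = forests k n); last first.
  by apply/seteqP; split=> s [].
by apply: eq_fsbigr => s; rewrite inE => -[/= -> _].
Qed.

End plane_forests.

(** * The recursion for trees and the power series identities *)

Section tree_series.
Variables (R : realType) (beta : R) (r : nat -> R).
Variable mu : probability (measurableTypeR R) R.

Local Notation W := (stationary_weights beta r).
Local Notation f := (fun t => bare_green W t * omega mu t).
Local Notation Y := (Y_series beta r mu).

Lemma omega_node s :
  omega mu (PNode s) = moment mu (size s).+1 * \prod_(u <- s) omega mu u.
Proof.
rewrite /omega /= big_cons; congr (_ * _).
by rewrite big_flatten big_map.
Qed.

Lemma quotient_omega t : bare_green_quotient W t * omega mu t =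
  moment mu (size (children t)).+1 * \prod_(u <- children t) f u.
Proof.
by case: t => s; rewrite omega_node mulrCA /= big_split.
Qed.

Lemma even_limit_tree_sum n :
  tree_sum f n.+1 = W n.+1 * even_limit beta r mu n.
Proof.
rewrite /tree_sum /even_limit mulr_fsumr; apply: eq_fsbigr => t.
by rewrite inE /plane_trees /= bare_greenE => ->; rewrite mulrA.
Qed.

(** Multiplying the limit by its weight restores the factor of the root omitted by the quotient. *)
Lemma tree_sum_Y_series : tree_sum f = Y.
Proof.
apply/funext => -[|n]; last exact: even_limit_tree_sum.
rewrite /tree_sum (_ : plane_trees 0 = set0) ?fsbig_set0//.
by apply/seteqP; split=> t //; rewrite /plane_trees/=; have := nodes_gt0 t; lia.
Qed.

(* Forests with n nodes hanging from a root that already has [j] other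
   children, whence its moment of order k + j + 1. *)
Definition shifted_limit (j n : nat) : R :=
  \sum_(k < n.+1) moment mu (k + j).+1 * fps_exp Y k n.

Lemma shifted_limit_even n : shifted_limit 0 n = even_limit beta r mu n.
Proof.
rewrite /even_limit.
under eq_fsbigr do rewrite quotient_omega.
rewrite (tree_sum_root f (fun k => moment mu k.+1)) /shifted_limit.
by apply: eq_bigr => k _; rewrite addn0 forest_sum_exp tree_sum_Y_series.
Qed.

Lemma even_limit_comp n :
  fps_comp (psi mu) Y n = even_limit beta r mu n.
Proof.
rewrite -shifted_limit_even; apply: eq_bigr => k _.
by rewrite addn0.
Qed.

Lemma fps_exp_eq0 k n : (n < k)%N -> fps_exp Y k n = 0.
Proof.
elim: k n => // k IH n nk; rewrite /= /fps_mul big_ord_recl /= mul0r add0r.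
by rewrite big1// => i _; rewrite IH ?mulr0//= /bump; have := ltn_ord i; lia.
Qed.

Lemma shifted_limit0 j : shifted_limit j 0 = moment mu j.+1.
Proof. by rewrite /shifted_limit big_ord1 /= add0n mulr1. Qed.

(** Splitting Y^(k+1) into Y times Y^k detaches the first subtree, with [a.+1] nodes; it joins the
    [j] other children of the root. This mirrors the removal of the first excursion of a walk. *)
Lemma shifted_limitS j n : shifted_limit j n.+1 =
  \sum_(a < n.+1) W a.+1 * shifted_limit 0 a * shifted_limit j.+1 (n - a).
Proof.
under [RHS]eq_bigr do rewrite shifted_limit_even.
rewrite /shifted_limit big_ord_recl /= mulr0 add0r.
under eq_bigr do rewrite /fps_mul big_ord_recl /= mul0r add0r mulr_sumr.
rewrite exchange_big/=; apply: eq_bigr => a _.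
set c := W a.+1 * even_limit beta r mu a.
(* Y has no constant term, so Y^k does not reach degree [n - a] when [k > n - a]. *)
rewrite (mulr_sumr _ _ _ c) [LHS](bigID (fun k : 'I_n.+1 => (k < (n - a).+1)%N))/=.
rewrite [X in _ + X]big1 ?addr0 => [|k]; last first.
  by rewrite -leqNgt /bump /= subSS => ?; rewrite fps_exp_eq0 ?mulr0//; lia.
have le_na : ((n - a).+1 <= n.+1)%N by rewrite ltnS leq_subr.
rewrite [RHS](big_ord_widen n.+1 (fun k => c *
  (moment mu (k + j.+1).+1 * fps_exp Y k (n - a)%N)) le_na).
apply: eq_bigr => k _; rewrite /bump /= !add1n subSS addSnnS.
by rewrite mulrCA.
Qed.

(** Coefficientwise, the factor [n.+1] of the derivative cancels the division in the formula for
    [W n.+1], leaving L(n + 1) times a coefficient of psi(Y). *)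
Lemma Y_series_ode (l : nat -> R) :
  (forall k : nat, (1 <= k)%N -> W k = limn (pseries l k%:R) / k%:R) ->
  fps_deriv Y =1 fps_theta1 (fun x => limn (pseries l x)) (fps_comp (psi mu) Y).
Proof.
move=> Wl n; rewrite /fps_deriv /fps_theta1 even_limit_comp /= Wl//.
by rewrite mulrA mulrC; congr (_ * _); rewrite mulrC divfK// pnatr_eq0.
Qed.

Lemma even_limit_series :
  fps_from1 (fun k => even_limit beta r mu k.-1) =1
    fps_mul (@fpsX R) (fps_comp (psi mu) Y).
Proof.
move=> [|n]; rewrite /fps_mul /fpsX.
  by rewrite big_ord1 mul0r.
rewrite !big_ord_recl big1 /= ?mul0r ?add0r ?addr0; last first.
  by move=> i _; rewrite mul0r.
by rewrite mul1r /bump /= subn1 even_limit_comp.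
Qed.

End tree_series.

(** * Products of independent variables *)

Section product_expectation.
Context (R : realType) (d : measure_display) (T : measurableType d).
Variable P : probability T R.
Implicit Types X Z : T -> R.

Local Notation "\E f" := (Rintegral P setT f) (at level 10, f at next level).
Local Notation integrable f := (P.-integrable setT (EFin \o f)).

(** Only [X] is tested through events, while [Z] stays an arbitrary variable; independence can then
    be extended to expectations one variable at a time. *)
Definition uncorrelated_with_events X Z :=
  forall A : set R, measurable A ->
  \E (fun w => \1_(X @^-1` A) w * Z w) = \E (\1_(X @^-1` A)) * \E Z.

Lemma integrable_indicM (B : set T) Z : measurable B -> integrable Z ->
  integrable (fun w => \1_B w * Z w).
Proof.
move=> mB iZ; have /measurable_EFinP mZ := measurable_int _ iZ.
apply: le_integrable iZ => //.
  by apply/measurable_EFinP; exact: measurable_funM.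
move=> w _ /=; rewrite lee_fin normrM indicE.
by case: (w \in B); rewrite ?normr1 ?mul1r// normr0 mul0r.
Qed.

Lemma expectation1 : \E (fun=> 1) = 1.
Proof. by have := expectation_cst P 1; rewrite unlock /Rintegral => ->. Qed.

Lemma integrable_sumr (I : Type) (s : seq I) (f : I -> T -> R) :
  (forall i, integrable (f i)) -> integrable (fun w => \sum_(i <- s) f i w).
Proof.
move=> fi; have := @integrable_sum _ _ _ P setT measurableT _ s predT
  (fun i w => (f i w)%:E) (fun i _ => fi i).
by apply: eq_integrable => // w _; rewrite /= sumEFin.
Qed.

Lemma Rintegral_sum (I : Type) (s : seq I) (f : I -> T -> R) :
  (forall i, integrable (f i)) ->
  \E (fun w => \sum_(i <- s) f i w) = \sum_(i <- s) \E (f i).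
Proof.
move=> fi; elim: s => [|i s IH].
  under eq_Rintegral do rewrite big_nil.
  by rewrite Rintegral_cst// mul0r big_nil.
under eq_Rintegral do rewrite big_cons.
rewrite RintegralD// ?IH ?big_cons//.
exact: integrable_sumr.
Qed.

Lemma cvg_Rintegral_dominated (f_ : nat -> T -> R) (f g : T -> R) :
  (forall n, measurable_fun setT (f_ n)) -> measurable_fun setT f ->
  integrable g -> (forall w, f_ n w @[n --> \oo] --> f w) ->
  (forall n w, `|f_ n w| <= g w) ->
  \E (f_ n) @[n --> \oo] --> \E f.
Proof.
move=> mf_ mf ig cvgf domf.
have [|||//||iff _ +] := @dominated_convergence _ _ _ P setT measurableT
    (fun n => EFin \o f_ n) (EFin \o f) (EFin \o g).
- by move=> n; exact/measurable_EFinP.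
- exact/measurable_EFinP.
- by apply: aeW => w _; apply: cvg_EFin; [exact: nearW | exact: cvgf].
- by apply: aeW => w n _; rewrite /= lee_fin.
move=> cvgE; apply: fine_cvg; rewrite fineK//.
exact: integrable_fin_num.
Qed.

Import HBNNSimple.

Lemma uncorrelated_simple X Z (phi : {nnsfun measurableTypeR R >-> R}) :
  measurable_fun setT X -> integrable Z -> uncorrelated_with_events X Z ->
  \E (fun w => phi (X w) * Z w) = \E (phi \o X) * \E Z.
Proof.
move=> mX iZ XZ.
have phiE x : phi x =
    \sum_(y <- fset_set (range phi)) y * \1_(phi @^-1` [set y]) x.
  by rewrite {1}(fimfunE phi x) fsbig_finite.
pose A y := X @^-1` (phi @^-1` [set y]).
have mphi y : measurable (phi @^-1` [set y]).
  by apply: measurable_funPTI; exact: measurable_set1.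
have mA y : measurable (A y) by rewrite -[A y]setTI; exact: (mX measurableT _ (mphi y)).
have iA y : integrable (\1_(A y) : T -> R) by exact: integrable_indic.
transitivity (\E (fun w => \sum_(y <- fset_set (range phi))
    y * (\1_(A y) w * Z w))).
  apply: eq_Rintegral => w _; rewrite phiE big_distrl/=.
  by apply: eq_bigr => y _; rewrite mulrA.
have iAZ y := integrable_indicM (mA y) iZ.
rewrite Rintegral_sum; last first.
  by move=> y; exact: integrableZl (iAZ y).
transitivity (\E (fun w => \sum_(y <- fset_set (range phi)) y * \1_(A y) w)
    * \E Z); last by congr (_ * _); apply: eq_Rintegral => w _; rewrite /= phiE.
rewrite Rintegral_sum; last by move=> y; exact: integrableZl (iA y).
rewrite big_distrl/=; apply: eq_bigr => y _.
rewrite RintegralZl; [|by []|exact: iAZ].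
rewrite RintegralZl; [|by []|exact: iA].
by rewrite -mulrA; congr (_ * _); exact: XZ (mphi y).
Qed.

(** Simple functions increase to [h], but [Z] has no sign, so the limit is taken by domination by
    [h (X w) * Z w] in absolute value. *)
Lemma uncorrelated_ge0 X Z (h : R -> R) :
  measurable_fun setT X -> measurable_fun setT h -> (forall x, 0 <= h x) ->
  integrable Z -> integrable (h \o X) -> integrable (fun w => h (X w) * Z w) ->
  uncorrelated_with_events X Z ->
  \E (fun w => h (X w) * Z w) = \E (h \o X) * \E Z.
Proof.
move=> mX mh h0 iZ ih ihZ XZ.
have mhE : measurable_fun setT (EFin \o h : measurableTypeR R -> \bar R).
  exact/measurable_EFinP.
pose phi n : {nnsfun measurableTypeR R >-> R} := nnsfun_approx measurableT mhE n.
have hE0 (x : measurableTypeR R) : [set: measurableTypeR R] x ->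
  (0 <= (EFin \o h) x)%E by rewrite /= lee_fin.
have phi_cvg x : phi n x @[n --> \oo] --> h x.
  have := @cvg_approx _ _ _ _ _ x hE0 I (ltry (h x)).
  by under eq_fun do rewrite -(nnsfun_approxE measurableT mhE).
have phi_le n x : `|phi n x| <= h x.
  rewrite ger0_norm// -lee_fin /phi nnsfun_approxE.
  exact: (@le_approx _ _ _ setT (EFin \o h) n x hE0).
have mphi n : measurable_fun setT (phi n \o X).
  by apply: measurableT_comp => //.
have mZ : measurable_fun setT Z by exact/measurable_EFinP/(measurable_int _ iZ).
have cvg1 : \E (fun w => phi n (X w) * Z w) @[n --> \oo] -->
    \E (fun w => h (X w) * Z w).
  apply: (@cvg_Rintegral_dominated _ _ (fun w => `|h (X w) * Z w|)).
  - by move=> n; apply: measurable_funM => //; exact: mphi.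
  - exact/measurable_EFinP/(measurable_int _ ihZ).
  - exact: integrable_norm ihZ.
  - by move=> w; apply: cvgMl; exact: phi_cvg.
  - by move=> n w; rewrite !normrM ler_wpM2r// (ger0_norm (h0 _)).
have cvg2 : \E (phi n \o X) @[n --> \oo] --> \E (h \o X).
  apply: (@cvg_Rintegral_dominated _ _ (h \o X)) => //.
  - exact/measurable_EFinP/(measurable_int _ ih).
  - by move=> w; exact: phi_cvg.
  - by move=> n w; exact: phi_le.
apply: (cvg_unique _ cvg1) => //.
have -> : (fun n => \E (fun w => phi n (X w) * Z w)) =
    (fun n => \E (phi n \o X) * \E Z).
  by apply/funext => n; exact: uncorrelated_simple.
exact: cvgMl.
Qed.

Lemma uncorrelated_expectationM X Z :
  measurable_fun setT X -> integrable X -> integrable Z ->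
  integrable (fun w => X w * Z w) -> uncorrelated_with_events X Z ->
  \E (fun w => X w * Z w) = \E X * \E Z.
Proof.
move=> mX iX iZ iXZ XZ.
have mZ : measurable_fun setT Z by exact/measurable_EFinP/(measurable_int _ iZ).
pose hp (x : R) := Num.max x 0; pose hn (x : R) := Num.max (- x) 0.
have mhp : measurable_fun setT hp by exact: measurable_funrpos.
have mhn : measurable_fun setT hn by exact: measurable_funrneg.
have le_hp x : `|hp x| <= `|x|.
  by rewrite /hp; case: (lerP x 0) => x0; rewrite ?normr0.
have le_hn x : `|hn x| <= `|x|.
  by rewrite /hn; case: (lerP (- x) 0) => x0; rewrite ?normr0// normrN.
have iM (h : R -> R) : measurable_fun setT h -> (forall x, `|h x| <= `|x|) ->
    integrable (h \o X) /\ integrable (fun w => h (X w) * Z w).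
  move=> mh le_h; have mhX : measurable_fun setT (h \o X).
    exact: measurableT_comp.
  split; [apply: le_integrable iX|apply: le_integrable iXZ] => //.
  - exact/measurable_EFinP.
  - by move=> w _; rewrite /= lee_fin.
  - by apply/measurable_EFinP; apply: measurable_funM.
  - by move=> w _; rewrite /= lee_fin !normrM ler_wpM2r.
have [ip ipZ] := iM _ mhp le_hp; have [ineg inZ] := iM _ mhn le_hn.
have XE x : x = hp x - hn x.
  by rewrite /hp /hn; case: (ltrgtP x 0) => [x0|x0|->]; rewrite ?oppr0 ?maxxx ?subrr//;
    [rewrite (max_idPl _) ?sub0r ?opprK// oppr_ge0 ltW
    |rewrite (max_idPr _) ?subr0// oppr_le0 ltW].
transitivity (\E (fun w => hp (X w) * Z w - hn (X w) * Z w)).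
  by apply: eq_Rintegral => w _; rewrite {1}(XE (X w)) mulrBl.
rewrite RintegralB// !uncorrelated_ge0//; last 2 first.
- by move=> x; rewrite le_max lexx orbT.
- by move=> x; rewrite le_max lexx orbT.
rewrite -mulrBl -RintegralB//; congr (_ * _).
by apply: eq_Rintegral => w _; rewrite /= -XE.
Qed.

End product_expectation.

(** * Independence of events carried over to products of variables *)

Section independent_products.
Context (R : realType) (d : measure_display) (T : measurableType d).
Variable P : probability T R.

Local Notation "\E f" := (Rintegral P setT f) (at level 10, f at next level).
Local Notation integrable f := (P.-integrable setT (EFin \o f)).

Lemma Rintegral_indic (A : set T) : measurable A -> \E (\1_A) = fine (P A).
Proof. by move=> mA; rewrite /Rintegral integral_indic// setIT. Qed.

(** The mixed form makes the induction work: to separate [X i] from the others, it is replaced by an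
    indicator, which moves [i] from the list [s] of variables to the list [t] of events. *)
Lemma mutually_independent_prod_mixed (I : choiceType) (D : set I)
    (F : I -> set (set T)) (X : I -> T -> R) (s t : seq I) (E : I -> set T) :
  mutually_independent P D F -> (forall i A, D i -> F i A -> measurable A) ->
  uniq (s ++ t) -> (forall i, i \in s ++ t -> D i) ->
  (forall i A, i \in s -> measurable A -> F i (X i @^-1` A)) ->
  (forall s', integrable (fun w => \prod_(i <- s') X i w)) ->
  (forall i, i \in t -> F i (E i)) ->
  \E (fun w => \1_(\bigcap_(i in [set` t]) E i) w * \prod_(i <- s) X i w) =
  \prod_(i <- t) fine (P (E i)) * \prod_(i <- s) \E (X i).
Proof.
move=> indF mF + + + iX.
have iXi i : integrable (X i).
  by have := iX [:: i]; apply: eq_integrable => // w _; rewrite /= big_seq1.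
have mcap (t' : seq I) (E' : I -> set T) : (forall i, i \in t' -> D i) ->
    (forall i, i \in t' -> F i (E' i)) ->
    measurable (\bigcap_(i in [set` t']) E' i).
  move=> t'D FE'; apply: fin_bigcap_measurable; first exact: finite_seq.
  by move=> i it'; exact: mF (t'D _ it') (FE' _ it').
elim: s t E => [|i s IH] t E /= uniqst stD FX FE.
  under eq_Rintegral do rewrite big_nil mulr1.
  rewrite big_nil mulr1 Rintegral_indic; last exact: mcap.
  have eqt : [set` [fset x in t]%fset] = [set` t].
    by apply/seteqP; split=> x; rewrite /= inE.
  have := indF [fset x in t]%fset; rewrite eqt => ->.
  - have pt : perm_eq [fset x in t]%fset t.
      by apply: uniq_perm => // x; rewrite inE.
    rewrite (perm_big _ pt)/=.
    rewrite big_seq [in RHS]big_seq.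
    rewrite (eq_bigr (fun i => (fine (P (E i)))%:E)) ?prodEFin// => i it.
    rewrite fineK// fin_num_measure//; exact: mF (stD _ it) (FE _ it).
  - by move=> x; exact: stD.
  - by move=> j; rewrite inE => /FE.
have /andP[iNst uniqst'] := uniqst.
have iNt : i \notin t by apply: contra iNst; rewrite mem_cat orbC => ->.
pose Z w := \1_(\bigcap_(i in [set` t]) E i) w * \prod_(i <- s) X i w.
have iZ (t' : seq I) (E' : I -> set T) s' : (forall i, i \in t' -> D i) ->
    (forall i, i \in t' -> F i (E' i)) ->
    integrable (fun w => \1_(\bigcap_(i in [set` t']) E' i) w *
      \prod_(i <- s') X i w).
  by move=> t'D FE'; exact: integrable_indicM (mcap _ _ t'D FE') (iX s').
have sD j : j \in s ++ t -> D j by move=> jst; apply: stD; rewrite inE jst orbT.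
have tD j : j \in t -> D j by move=> jt; apply: sD; rewrite mem_cat jt orbT.
have EZ : \E Z = \prod_(i <- t) fine (P (E i)) * \prod_(i <- s) \E (X i).
  apply: IH => // j A js; apply: FX.
  by rewrite inE js orbT.
transitivity (\E (fun w => X i w * Z w)).
  by apply: eq_Rintegral => w _; rewrite big_cons mulrCA.
rewrite big_cons mulrCA -EZ; apply: uncorrelated_expectationM => //.
- exact/measurable_EFinP/(measurable_int _ (iXi i)).
- exact: iZ.
- have := iZ t E (i :: s) tD FE; apply: eq_integrable => // w _.
  by rewrite /= big_cons mulrCA.
move=> A mA; pose E' j := if j == i then X i @^-1` A else E j.
have E't j : j \in t -> E' j = E j.
  by move=> jt; rewrite /E'; case: eqP => // ji; rewrite -ji jt in iNt.
transitivity (\E (fun w => \1_(\bigcap_(j in [set` (i :: t)]) E' j) w *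
   \prod_(j <- s) X j w)).
  apply: eq_Rintegral => w _; rewrite mulrA; congr (_ * _).
  rewrite -[LHS]/((\1_(X i @^-1` A) \* \1_(\bigcap_(i in [set` t]) E i)) w).
  rewrite -indicI; congr (\1__ w); apply/seteqP; split=> v /=.
    move=> [XiA capE] j /=; rewrite inE => /predU1P[->|jt].
      by rewrite /E' eqxx.
    by rewrite E't//; exact: capE.
  move=> capE'; split.
    by have := capE' i; rewrite /E' /= inE eqxx; apply.
  by move=> j jt; rewrite -E't//; apply: capE'; rewrite /= inE [_ \in t]jt orbT.
rewrite IH//.
- rewrite big_cons {1}/E' eqxx EZ Rintegral_indic ?mulrA//.
    congr (_ * _ * _); rewrite big_seq [RHS]big_seq.
    by apply: eq_bigr => j jt; rewrite E't.
  apply: (mF i); first by apply: stD; rewrite inE eqxx.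
  by apply: FX; rewrite ?inE ?eqxx.
- by rewrite (perm_uniq (_ : perm_eq _ (i :: s ++ t)))// -cat1s perm_catCA.
- by move=> j; rewrite mem_cat inE orbCA -mem_cat => /stD.
- by move=> j B js; apply: FX; rewrite inE js orbT.
- move=> j; rewrite inE => /predU1P[->|jt]; last by rewrite E't//; exact: FE.
  by rewrite /E' eqxx; apply: FX; rewrite ?inE ?eqxx.
Qed.

Lemma mutually_independent_expectation_prod (I : choiceType) (D : set I)
    (F : I -> set (set T)) (X : I -> T -> R) (s : seq I) :
  mutually_independent P D F -> (forall i A, D i -> F i A -> measurable A) ->
  uniq s -> (forall i, i \in s -> D i) ->
  (forall i A, i \in s -> measurable A -> F i (X i @^-1` A)) ->
  (forall s', integrable (fun w => \prod_(i <- s') X i w)) ->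
  \E (fun w => \prod_(i <- s) X i w) = \prod_(i <- s) \E (X i).
Proof.
move=> indF mF us sD FX iX.
have := mutually_independent_prod_mixed (t := [::]) (E := fun=> setT)
  indF mF _ _ FX iX.
rewrite cats0 big_nil mul1r => <- //.
by apply: eq_Rintegral => w _; rewrite indicE mem_set ?mul1r// => i.
Qed.

(** [uncorrelated_expectationM] is used twice: for [X] against [Z], and, to check its hypothesis,
    for [Z] against the indicator of an event of [X]. *)
Lemma independent_systems_expectationM (F G : set (set T)) (X Z : T -> R) :
  independent_systems P F G ->
  (forall A, F A -> measurable A) -> (forall A, G A -> measurable A) ->
  (forall A, measurable A -> F (X @^-1` A)) ->
  (forall A, measurable A -> G (Z @^-1` A)) ->
  integrable X -> integrable Z -> integrable (fun w => X w * Z w) ->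
  \E (fun w => X w * Z w) = \E X * \E Z.
Proof.
move=> indFG mF mG FX GZ iX iZ iXZ.
have /measurable_EFinP mX := measurable_int _ iX.
have /measurable_EFinP mZ := measurable_int _ iZ.
apply: uncorrelated_expectationM => // A /FX FA.
have mA := mF _ FA; have iA := integrable_indic P mA.
under eq_Rintegral do rewrite mulrC.
rewrite mulrC; apply: uncorrelated_expectationM => //.
  by under eq_fun do rewrite mulrC; exact: integrable_indicM.
move=> B /GZ GB.
rewrite (_ : (fun w => _) = \1_(Z @^-1` B `&` X @^-1` A)); last first.
  by rewrite indicI.
have mB := mG _ GB.
rewrite !Rintegral_indic//; last exact: measurableI.
by rewrite setIC indFG// mulrC fineM// fin_num_measure.
Qed.

End independent_products.

(** With M the maximum of 1 and of the absolute values, the product is at most M^K, which is either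
    1 or a term of the sum. This takes the place of the Hölder inequality. *)
Lemma prod_norm_le_sum_exp (R : realDomainType) (s : seq R) (K : nat) :
  (size s <= K)%N -> \prod_(y <- s) `|y| <= 1 + \sum_(y <- s) `|y| ^+ K.
Proof.
suff [M [M1 prodM powM]] : exists M : R,
    [/\ 1 <= M, \prod_(y <- s) `|y| <= M ^+ size s &
        M ^+ K <= 1 + \sum_(y <- s) `|y| ^+ K].
  by move=> sK; apply: le_trans prodM (le_trans _ powM); exact: ler_weXn2l.
elim: s => [|y s [M [M1 prodM powM]]].
  by exists 1; rewrite !big_nil !expr1n addr0.
have prod0 : 0 <= \prod_(z <- s) `|z| by exact: prodr_ge0.
have sum0 : 0 <= \sum_(z <- s) `|z| ^+ K.
  by apply: sumr_ge0 => z _; rewrite exprn_ge0.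
rewrite !big_cons /=; have [yM|/ltW My] := lerP `|y| M.
  exists M; rewrite exprS; split => //; first by rewrite ler_pM.
  by rewrite (le_trans powM)// lerD2l lerDr exprn_ge0.
exists `|y|; rewrite exprS; split; first exact: le_trans My.
  rewrite ler_wpM2l// (le_trans prodM)// lerXn2r ?nnegrE//.
  exact: le_trans M1.
by rewrite addrCA lerDl addr_ge0.
Qed.

Section moment_bounds.
Context (R : realType) (d : measure_display) (T : measurableType d).
Variable P : probability T R.

Local Notation "\E f" := (Rintegral P setT f) (at level 10, f at next level).
Local Notation integrable f := (P.-integrable setT (EFin \o f)).

Variables (I : Type) (X : I -> T -> R).
Hypothesis mX : forall i, measurable_fun setT (X i).
Hypothesis iX : forall i k, (2 <= k)%N -> integrable (fun w => `|X i w| ^+ k).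

Let bound (s : seq I) k w := 1 + \sum_(i <- s) `|X i w| ^+ k.

Let integrable_bound s k : (2 <= k)%N -> integrable (bound s k).
Proof.
move=> k2; have iS : integrable (fun w => \sum_(i <- s) `|X i w| ^+ k).
  by apply: integrable_sumr => i; exact: iX.
have i1 : P.-integrable setT (EFin \o cst 1).
  exact: finite_measure_integrable_cst.
by have := integrableD measurableT i1 iS; exact: eq_integrable.
Qed.

Let prod_le_bound s k w : (size s <= k)%N ->
  `|\prod_(i <- s) X i w| <= bound s k w.
Proof.
move=> sk; rewrite normr_prod.
have := @prod_norm_le_sum_exp R [seq X i w | i <- s] k.
by rewrite size_map !big_map; apply.
Qed.

Lemma integrable_prod (s : seq I) : integrable (fun w => \prod_(i <- s) X i w).
Proof.
(* The exponent [size s + 2] is at least the number of factors and at least 2, the lowest order of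
   the moments at hand. *)
apply: le_integrable (integrable_bound s (leq_addl (size s) 2)) => //.
  apply/measurable_EFinP; elim: s => [|i s IH].
    by under eq_fun do rewrite big_nil; exact: measurable_cst.
  by under eq_fun do rewrite big_cons; exact: measurable_funM.
move=> w _; rewrite /= lee_fin (le_trans (prod_le_bound w (leq_addr 2 _)))//.
exact: ler_norm.
Qed.

Lemma norm_expectation_prod_le (s : seq I) (k : nat) :
  (2 <= k)%N -> (size s <= k)%N ->
  `|\E (fun w => \prod_(i <- s) X i w)| <=
    1 + \sum_(i <- s) \E (fun w => `|X i w| ^+ k).
Proof.
move=> k2 sk; apply: le_trans (le_normr_Rintegral measurableT _) _.
  exact: integrable_prod.
apply: (@le_trans _ _ (\E (bound s k))).
  apply: le_Rintegral => //; first exact: integrable_norm (integrable_prod s).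
    exact: integrable_bound.
  by move=> w _; exact: prod_le_bound.
rewrite /bound RintegralD//.
- rewrite expectation1 Rintegral_sum//.
  by move=> i; exact: iX.
- exact: finite_measure_integrable_cst.
by apply: integrable_sumr => i; exact: iX.
Qed.
End moment_bounds.

(** * Expectation of the normalized trace *)

Section sigma_process_theory.
Context (R : realType) (d : measure_display) (T : measurableType d).
Variables (I : eqType) (D : set I) (X : I -> T -> R).

Lemma sigma_process_measurable : (forall i, measurable_fun setT (X i)) ->
  forall A, sigma_process D X A -> measurable A.
Proof.
move=> mX; apply: smallest_sub; first exact: sigma_algebra_measurable.
by move=> A [i _ [B mB <-]]; exact: mX.
Qed.

Lemma sigma_process_prod (s : seq I) : (forall i, i \in s -> D i) ->
  forall A, measurable A ->
  sigma_process D X ((fun w => \prod_(i <- s) X i w) @^-1` A).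
Proof.
move=> sD A mA.
(* Equipping [T] with the generated sigma-algebra makes the stability of measurable functions under
   products applicable. *)
pose gT := g_sigma_algebraType
  (\bigcup_(i in D) preimage_set_system setT (X i) measurable).
suff: measurable_fun (setT : set gT) (fun w : gT => \prod_(i <- s) X i w).
  by move=> /(_ measurableT _ mA); rewrite setTI.
elim: s sD => [|i s IH] sD.
  rewrite (_ : (fun w : gT => _) = cst 1); first exact: measurable_cst.
  by apply/funext => w; rewrite big_nil.
rewrite (_ : (fun w : gT => _) =
    (fun w : gT => X i w * \prod_(j <- s) X j w)); last first.
  by apply/funext => w; rewrite big_cons.
apply: measurable_funM; last first.
  by apply: IH => j js; apply: sD; rewrite inE js orbT.
move=> _ B mB; apply: sub_sigma_algebra; exists i.
  by apply: sD; rewrite mem_head.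
by exists B.
Qed.

End sigma_process_theory.

Section diagonal_moments.
Context (R : realType) (d : measure_display) (T : measurableType d).
Variables (P : probability T R) (mu : probability (measurableTypeR R) R).
Variable L : {RV P >-> R}.
Hypothesis law_L : forall A, measurable A -> distribution P L A = mu A.
Hypothesis mu_moments :
  forall k : nat, mu.-integrable setT (EFin \o (fun x : R => x ^+ k)).

Let L' : T -> measurableTypeR R := L.

Let mL' : measurable_fun setT L'.
Proof.
have mL : measurable_fun setT L by exact: measurable_funPT.
by move=> _ A mA; exact: mL.
Qed.

Lemma ge0_integral_law (f : measurableTypeR R -> \bar R) :
  measurable_fun setT f -> (forall x, (0 <= f x)%E) ->
  (\int[mu]_x f x = \int[P]_w f (L w))%E.
Proof.
move=> mf f0; have := ge0_integral_pushforward mL' P (D := setT) measurableT mf.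
rewrite preimage_setT => <- //; apply: eq_measure_integral => A mA _.
exact/esym/law_L.
Qed.

Lemma integral_law (f : measurableTypeR R -> \bar R) :
  measurable_fun setT f -> P.-integrable setT (f \o L) ->
  (\int[mu]_x f x = \int[P]_w f (L w))%E.
Proof.
move=> mf iLf; have := integral_pushforward mL' (mu := P) (D := setT) mf.
rewrite preimage_setT => <- //; apply: eq_measure_integral => A mA _.
exact/esym/law_L.
Qed.

Lemma measurable_EFin_exprn k :
  measurable_fun setT (fun x : measurableTypeR R => (x ^+ k)%:E).
Proof. by apply/measurable_EFinP; exact: exprn_measurable. Qed.

Lemma integrable_rv_exp k : P.-integrable setT (EFin \o (fun w => L w ^+ k)).
Proof.
have /integrableP[_] := mu_moments k.
rewrite (@ge0_integral_law (fun x => `|(x ^+ k)%:E|)%E)//.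
  move=> oo; apply/integrableP; split => //.
  by apply/measurable_EFinP; exact: measurable_funX.
by apply: measurableT_comp => //; exact: measurable_EFin_exprn.
Qed.

Lemma expectation_rv_exp k :
  Rintegral P setT (fun w => L w ^+ k) = moment mu k.
Proof.
rewrite /moment /Rintegral (@integral_law (fun x => (x ^+ k)%:E))//.
  exact: measurable_EFin_exprn.
exact: integrable_rv_exp.
Qed.

Lemma expectation_rv_norm_exp k :
  Rintegral P setT (fun w => `|L w| ^+ k) =
  Rintegral mu setT (fun x => `|x| ^+ k).
Proof.
rewrite /Rintegral (@ge0_integral_law (fun x => (`|x| ^+ k)%:E))//.
apply/measurable_EFinP; apply: measurable_funX.
exact: normr_measurable.
Qed.

End diagonal_moments.

(** * Expectation of the term of one walk *)

Section one_walk.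
Context (R : realType) (d : measure_display) (T : measurableType d).
Variables (P : probability T R) (mu : probability (measurableTypeR R) R).
Variables (N : nat) (G : nat -> random_entries P N) (lam : 'I_N -> {RV P >-> R}).
Variables (beta : R) (r : nat -> R).

Local Notation "\E f" := (Rintegral P setT f) (at level 10, f at next level).
Local Notation integrable f := (P.-integrable setT (EFin \o f)).

Hypothesis mu_moments :
  forall k : nat, mu.-integrable setT (EFin \o (fun x : R => x ^+ k)).
Hypothesis lam_law :
  forall j A, measurable A -> distribution P (lam j) A = mu A.
Hypothesis lam_indep :
  mutually_independent P setT (fun j => sigma_variable (lam j)).
Hypothesis lam_G_indep : independent_systems P
  (sigma_process setT (fun j => lam j))
  (sigma_process [set x : nat * ('I_N * 'I_N) | times x.1]
    (fun x => G x.1 x.2.1 x.2.2)).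
Hypothesis G_indep : mutually_independent P (@upper_pairs N)
  (fun p => sigma_process times (fun k => G k p.1 p.2)).
Hypothesis G_moments : forall k i j K, (0 < k)%N -> (2 <= K)%N ->
  integrable (fun w => `|G k i j w| ^+ K).
Hypothesis G_centered : forall k i j, (0 < k)%N -> \E (G k i j) = 0.
Hypothesis G_covariance : forall k m i j, i != j -> (0 < m)%N -> (m < k)%N ->
  \E (fun w => G k i j w * G m i j w) = beta ^+ 2 * r (k - m)%N.

(* Only the times k >= 1 are constrained, and k.-1.+1 = k for those. *)
Definition gam (z : 'I_N * 'I_N * nat) : T -> R := G z.2.-1.+1 z.1.1 z.1.2.

(** A single family for both kinds of entries, so that the moment bounds apply to mixed products. *)
Definition walk_variable (i : 'I_N + 'I_N * 'I_N * nat) : T -> R :=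
  match i with inl v => lam v | inr z => gam z end.

Lemma measurable_walk_variable i : measurable_fun setT (walk_variable i).
Proof. by case: i => [v|z]; exact: measurable_funPT. Qed.

Lemma walk_variable_moments i K : (2 <= K)%N ->
  integrable (fun w => `|walk_variable i w| ^+ K).
Proof.
move=> K2; case: i => [v|z]; last exact: G_moments.
have := integrable_norm (integrable_rv_exp (lam_law v) mu_moments K).
by apply: eq_integrable => // w _; rewrite /= normrX.
Qed.

Lemma integrable_walk_variables s :
  integrable (fun w => \prod_(i <- s) walk_variable i w).
Proof.
exact: integrable_prod measurable_walk_variable walk_variable_moments _.
Qed.

Lemma integrable_gams s : integrable (fun w => \prod_(z <- s) gam z w).
Proof.
have := integrable_walk_variables (map inr s).
by apply: eq_integrable => // w _; rewrite /= big_map.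
Qed.

Definition walk_term (x : 'I_N) (p : seq 'I_N) (w : T) : R :=
  \prod_(v <- x :: p) lam v w * \prod_(z <- steps 1 x p) gam z w.

Lemma walk_termE x p w : walk_term x p w =
  \prod_(i <- map inl (x :: p) ++ map inr (steps 1 x p)) walk_variable i w.
Proof. by rewrite big_cat !big_map. Qed.

Lemma integrable_walk_term x p : integrable (walk_term x p).
Proof.
have := integrable_walk_variables (map inl (x :: p) ++ map inr (steps 1 x p)).
by apply: eq_integrable => // w _; rewrite /= walk_termE.
Qed.

Definition gam_moment (e : 'I_N * 'I_N) (ts : seq nat) : R :=
  \E (fun w => \prod_(t <- ts) gam (e, t) w).

Lemma gam_moment_nil e : gam_moment e [::] = 1.
Proof.
rewrite /gam_moment -[RHS](expectation1 P); apply: eq_Rintegral => w _.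
by rewrite big_nil.
Qed.

Lemma gam_moment1 e t : gam_moment e [:: t] = 0.
Proof.
rewrite -(G_centered e.1 e.2 (ltn0Sn t.-1)); apply: eq_Rintegral => w _.
by rewrite big_seq1.
Qed.

(** Covariances are prescribed off the diagonal only; tree walks contain no loop, so no others occur
    in the limit. *)
Lemma gam_moment_pair (x y : 'I_N) (s t : nat) : x != y ->
  (0 < s)%N -> (s < t)%N ->
  gam_moment (edge x y) [:: s; t] = beta ^+ 2 * r (t - s)%N.
Proof.
move=> xy s0 st; have exy : (edge x y).1 != (edge x y).2.
  by rewrite /edge; case: ifP => _ //=; rewrite eq_sym.
rewrite -(G_covariance exy s0 st); apply: eq_Rintegral => w _.
rewrite big_cons big_seq1 mulrC /gam /=.
by rewrite !prednK// (leq_ltn_trans _ st).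
Qed.

Lemma edges_upper (x : 'I_N) p e : e \in edges x p -> (e.1 <= e.2)%N.
Proof.
move=> /edges_edge[u [v ->]]; rewrite /edge; case: ifP => //= /negbT.
by rewrite -ltnNge => /ltnW.
Qed.

Lemma prod_times_of (f : 'I_N * 'I_N * nat -> R) (s : seq ('I_N * 'I_N * nat)) :
  \prod_(z <- s) f z = \prod_e \prod_(t <- times_of e s) f (e, t).
Proof.
rewrite (partition_big fst predT)//=; apply: eq_bigr => e _.
rewrite /times_of big_map big_filter; apply: eq_bigr => z /eqP <-.
by case: z.
Qed.

Lemma expectation_gams x p :
  \E (fun w => \prod_(z <- steps 1 x p) gam z w) =
  edge_weight gam_moment (steps 1 x p).
Proof.
pose st := steps 1 x p.
(* Independence holds among the upper pairs; the other pairs encode no edge, are never traversed and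
   contribute the factor 1. *)
pose up := [seq e : 'I_N * 'I_N <- index_enum ('I_N * 'I_N)%type | (e.1 <= e.2)%N].
pose Xe e w := \prod_(t <- times_of e st) gam (e, t) w.
have prod_up (f : 'I_N * 'I_N -> R) :
    (forall e : 'I_N * 'I_N, ~~ (e.1 <= e.2)%N -> f e = 1) ->
    \prod_e f e = \prod_(e <- up) f e.
  move=> f1; rewrite big_filter (bigID (fun e : 'I_N * 'I_N => e.1 <= e.2)%N)/=.
  by rewrite [X in _ * X]big1 ?mulr1.
have low (e : 'I_N * 'I_N) : ~~ (e.1 <= e.2)%N -> times_of e st = [::].
  by move=> el; apply: times_of_eq0; apply: contra el; exact: edges_upper.
rewrite /edge_weight prod_up => [|e /low ->]; last exact: gam_moment_nil.
transitivity (\E (fun w => \prod_(e <- up) Xe e w)).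
  apply: eq_Rintegral => w _; rewrite prod_times_of prod_up// => e /low.
  by rewrite -/st => ->; rewrite big_nil.
apply: (mutually_independent_expectation_prod G_indep).
- move=> e A _; apply: sigma_process_measurable => k; exact: measurable_funPT.
- by rewrite filter_uniq// index_enum_uniq.
- by move=> e; rewrite mem_filter => /andP[].
- move=> e A _ mA.
  have := @sigma_process_prod _ _ _ _ times (fun k => G k e.1 e.2)
    [seq t.-1.+1 | t <- times_of e st].
  move=> /(_ _ A mA); rewrite (_ : (fun w => _) = Xe e); first by
    apply => _ /mapP[t _ ->].
  by apply/funext => w; rewrite big_map.
move=> s; have := integrable_walk_variables
  (flatten [seq [seq inr (e, t) | t <- times_of e st] | e <- s]).
apply: eq_integrable => // w _ /=; rewrite big_flatten big_map.
by congr EFin; apply: eq_bigr => e _; rewrite big_map.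
Qed.

Lemma expectation_lams l :
  \E (fun w => \prod_(v <- l) lam v w) = vertex_weight (moment mu) l.
Proof.
have prodE w : \prod_(v <- l) lam v w = \prod_v lam v w ^+ count_mem v l.
  rewrite (partition_big id predT)//=; apply: eq_bigr => v _.
  rewrite -big_filter (eq_big_seq (fun=> lam v w)) => [|u].
    by rewrite big_const_seq count_predT size_filter iter_mulr mulr1.
  by rewrite mem_filter => /andP[/eqP ->].
have -> : (fun w => \prod_(v <- l) lam v w) =
    (fun w => \prod_(v <- enum 'I_N) lam v w ^+ count_mem v l).
  by apply/funext => w; rewrite prodE big_enum.
rewrite (mutually_independent_expectation_prod
  (X := fun v w => lam v w ^+ count_mem v l) lam_indep) ?enum_uniq//.
- rewrite big_enum; apply: eq_bigr => v _.
  exact: expectation_rv_exp (lam_law v) mu_moments _.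
- move=> v A _; apply: (@sigma_process_measurable _ _ _ unit) => _.
  exact: measurable_funPT.
- move=> v A _ mA.
  (* The power is written as a product over copies of the only index of the one-variable process. *)
  have := @sigma_process_prod _ _ _ unit setT (fun=> lam v)
    (nseq (count_mem v l) tt).
  move=> /(_ _ A mA); rewrite (_ : (fun w => _) =
    (fun w => lam v w ^+ count_mem v l)); first exact.
  by apply/funext => w; rewrite big_const_seq count_predT size_nseq iter_mulr mulr1.
move=> s; have := integrable_walk_variables
  (flatten [seq nseq (count_mem v l) (inl v) | v <- s]).
apply: eq_integrable => // w _ /=; rewrite big_flatten big_map.
congr EFin; apply: eq_bigr => v _.
by rewrite big_nseq iter_mulr mulr1.
Qed.

Lemma expectation_walk_term x p :
  \E (walk_term x p) = walk_weight gam_moment (moment mu) 0 1 x p.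
Proof.
rewrite /walk_weight -expectation_gams -expectation_lams.
apply: (independent_systems_expectationM lam_G_indep).
- by apply: sigma_process_measurable => v; exact: measurable_funPT.
- by apply: sigma_process_measurable => v; exact: measurable_funPT.
- by apply: sigma_process_prod.
- move=> A mA.
  pose X (z : nat * ('I_N * 'I_N)) := G z.1 z.2.1 z.2.2.
  have := @sigma_process_prod _ _ _ _ [set z : nat * ('I_N * 'I_N) | times z.1]
    X [seq (z.2.-1.+1, z.1) | z <- steps 1 x p].
  move=> /(_ _ A mA); rewrite (_ : (fun w => _) =
    (fun w => \prod_(z <- steps 1 x p) gam z w)).
    by apply => _ /mapP[t _ ->].
  by apply/funext => w; rewrite big_map.
- have := integrable_walk_variables (map inl (x :: p)).
  apply: eq_integrable => // w _.
  by rewrite -[LHS]/((\prod_(i <- map inl (x :: p)) walk_variable i w)%:E) big_map.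
- exact: integrable_gams.
- exact: integrable_walk_term.
Qed.

End one_walk.

(** * Error bounds for the walk sums *)

Section walk_sum_estimates.
Variables (N : nat) (R : realType).
Hypothesis N_gt0 : (0 < N)%N.
Implicit Types (x y : 'I_N) (p : seq 'I_N).

(** The root and the walk together form a word of length [k.+1], whence the factorial. *)
Lemma norm_sum_words_le (f : 'I_N -> seq 'I_N -> R) (Q : 'I_N -> pred (seq 'I_N))
    (C : R) (k d : nat) : 0 <= C ->
  (forall x p, size p = k -> Q x p -> `|f x p| <= C) ->
  (forall x p, size p = k -> Q x p -> (d < ndistinct (x :: p))%N -> f x p = 0) ->
  `|\sum_x \sum_(p <- words N k | Q x p) f x p| <= C * (k.+1`! * N ^ d)%:R.
Proof.
move=> C0 fC f0.
apply: (@le_trans _ _ (C *+ \sum_(q <- words N k.+1 | (ndistinct q <= d)%N) 1)%N).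
  rewrite [in leRHS]big_mkcond [in leRHS]/= big_allpairs_dep big_enum /= -sumrMnr.
  apply: le_trans (ler_norm_sum _ _ _) _; apply: ler_sum => x _.
  apply: le_trans (ler_norm_sum _ _ _) _; rewrite -sumrMnr big_mkcond.
  rewrite big_seq [leRHS]big_seq; apply: ler_sum => p /size_words sp.
  have C0' (b : bool) : 0 <= C *+ (if b then 1 else 0)%N.
    by case: b.
  case: ifP => // Qp; case: leqP => [_|dp]; first by rewrite mulr1n fC.
  by rewrite f0// normr0.
by rewrite -[leLHS]mulr_natr ler_wpM2l// ler_nat count_words_few_letters.
Qed.

Variables (M : 'I_N * 'I_N -> seq nat -> R) (m : nat -> R) (W : nat -> R).
Hypothesis M_nil : forall e, M e [::] = 1.
Hypothesis m0 : m 0 = 1.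
Hypothesis M_single : forall e t, M e [:: t] = 0.
Hypothesis M_pair : forall x y s t, x != y -> (0 < s)%N -> (s < t)%N ->
  M (edge x y) [:: s; t] = W (t - s)%N.
Variable E : nat -> nat -> R.
Hypothesis E0 : forall j, E j 0 = m j.+1.
Hypothesis ES : forall j n, E j n.+1 =
  \sum_(a < n.+1) W a.*2.+1 * E 0 a * E j.+1 (n - a)%N.

Local Notation weight := (walk_weight M m 0 1).

Lemma walk_weight_eq0 x p :
  ~~ all (fun e => (2 <= count_mem e (edges x p))%N) (edges x p) ->
  weight x p = 0.
Proof.
move=> /allPn[e ep]; rewrite -ltnNge ltnS => e1.
rewrite /walk_weight /edge_weight (bigD1 e)//=.
have : size (times_of e (steps 1 x p)) = 1%N.
  rewrite size_times_of; apply/eqP; rewrite eqn_leq e1 -has_count.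
  by apply/hasP; exists e => //=.
case: (times_of e _) => [|t []]// _.
by rewrite M_single mul0r mulr0.
Qed.

Variables (k : nat) (C : R).
Hypothesis C_ge0 : 0 <= C.
Hypothesis weight_le : forall x p, size p = k -> `|weight x p| <= C.

Let walk_sum := \sum_x \sum_(p <- words N k | last x p == x) weight x p.

(** The subtracted term is the exact contribution of the tree walks. By [tree_walk_ge2], any other
    closed walk of nonzero weight has at most [n] distinct vertices. *)
Lemma walk_sum_even n : k = n.*2 ->
  `|walk_sum - (N ^_ n.+1)%:R * E 0 n| <= C * (k.+1`! * N ^ n)%:R.
Proof.
move=> kn.
have -> : (N ^_ n.+1)%:R * E 0 n =
    \sum_x \sum_(p <- words N k | (last x p == x) && tree_walk x p) weight x p.
  rewrite ffactnS natrM -mulrA.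
  transitivity (\sum_(x < N) (N.-1 ^_ n)%:R * E 0 n).
    by rewrite sumr_const card_ord -[RHS]mulr_natl.
  apply: eq_bigr => x _.
  (* One of N vertices is the root and the walk draws on the N - 1 others, which gives [N ^_ n.+1]
     in all. *)
  have xS : x \notin ([set: 'I_N] :\ x)%SET by rewrite !inE eqxx.
  have := sum_tree_walks M_nil m0 M_pair E0 ES n 0 (ltn0Sn 0) xS.
  rewrite (_ : #|_| = N.-1); last first.
    have := cardsD1 x [set: 'I_N]; rewrite !inE cardsT card_ord => /(congr1 predn).
    by rewrite add1n => ->.
  move=> <-; rewrite kn; apply: eq_bigl => p; rewrite /tree_walk_in.
  have -> : all [pred v | (v == x) || (v \in ([set: 'I_N] :\ x)%SET)] p.
    by apply/allP => v _; rewrite /= in_setD1 finset.in_setT andbT orbN.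
  by rewrite andbT; apply/idP/andP => [tw|[]//]; case/and3P: (tw).
rewrite /walk_sum -sumrB.
rewrite (eq_bigr (fun x => \sum_(p <- words N k | (last x p == x) && ~~ tree_walk x p)
   weight x p)) => [|x _]; last first.
  by rewrite (bigID (tree_walk x)) /= addrAC subrr add0r.
apply: norm_sum_words_le => // x p sp; first by move=> _; exact: weight_le.
case/andP => [/eqP px ntw] np; apply: walk_weight_eq0; apply: contra ntw => /allP p2.
by apply: tree_walk_ge2 => //; rewrite sp kn; lia.
Qed.

(** An odd length leaves at most [n.+1] distinct vertices, half a power of N short of the
    normalization N^(1 + k/2). *)
Lemma walk_sum_odd n : k = n.*2.+1 ->
  `|walk_sum| <= C * (k.+1`! * N ^ n.+1)%:R.
Proof.
move=> kn; apply: norm_sum_words_le => //.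
  by move=> x p sp _; exact: weight_le.
move=> x p sp _ np; apply: walk_weight_eq0; apply: contraL np => /allP p2.
by rewrite -leqNgt; have := ndistinct_walk_ge2 p2; rewrite sp kn; lia.
Qed.

End walk_sum_estimates.

Section limits_of_counts.
Variable R : realType.

Lemma cvg_invn : (N%:R : R)^-1 @[N --> \oo] --> (0 : R).
Proof. by rewrite -cvg_shiftS; exact: cvg_harmonic. Qed.

Lemma cvg_sqrt_invn : Num.sqrt (N%:R : R)^-1 @[N --> \oo] --> (0 : R).
Proof.
rewrite -(sqrtr0 R); apply: cvg_comp cvg_invn _.
exact: sqrt_continuous.
Qed.

Lemma cvg_ffact_ratio m :
  (N ^_ m)%:R / N%:R ^+ m @[N --> \oo] --> (1 : R).
Proof.
elim: m => [|m IH].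
  rewrite (_ : (fun N => _) = cst 1); first exact: cvg_cst.
  by apply/funext => N; rewrite ffactn0 expr0 divr1.
have cvg_sub : 1 - m%:R * (N%:R : R)^-1 @[N --> \oo] --> (1 : R).
  rewrite -[X in _ --> X]subr0 -[X in _ - X](mulr0 m%:R).
  by apply: cvgB; [exact: cvg_cst | apply: cvgMr; exact: cvg_invn].
have := cvgM IH cvg_sub; rewrite mulr1 => cvg1.
apply: cvg_trans; last exact: cvg1.
apply: near_eq_cvg; near=> N.
have N0 : (0 < N)%N by near: N; exists 1%N.
have mN : (m <= N)%N by near: N; exists m.
have NR0 : (N%:R : R) != 0 by rewrite pnatr_eq0 -lt0n.
rewrite /= ffactnSr natrM natrB// exprSr invfM mulrACA; congr (_ * _).
by rewrite mulrBl divff// mulrC.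
Unshelve. all: by end_near. Qed.

Lemma cvg_near_scaled (u v b : nat -> R) (l : R) :
  (\forall N \near \oo, `|u N - v N| <= b N) ->
  v N @[N --> \oo] --> l -> b N @[N --> \oo] --> (0 : R) ->
  u N @[N --> \oo] --> l.
Proof.
move=> ub vl b0; have : u N - v N @[N --> \oo] --> (0 : R).
  apply: norm_cvg0; apply: (@squeeze_cvgr _ _ _ _ (cst 0) b) => //; last first.
    exact: cvg_cst.
  by near=> N; rewrite normr_ge0 /=; near: N.
move=> /cvgD /(_ vl); rewrite add0r.
have -> : (fun N => u N) = (fun N => u N - v N) \+ v.
  by apply/funext => N /=; rewrite subrK.
exact.
Unshelve. all: by end_near. Qed.

End limits_of_counts.

Lemma integrable_expectation_le (R : realType) (d : measure_display)
    (T : measurableType d) (P : probability T R) (X : T -> R) (B : R) :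
  measurable_fun setT X -> (forall w, 0 <= X w) -> ('E_P[X] <= B%:E)%E ->
  P.-integrable setT (EFin \o X) /\ Rintegral P setT X <= B.
Proof.
move=> mX X0; rewrite unlock => XB.
have iX : P.-integrable setT (EFin \o X).
  apply/integrableP; split; first exact/measurable_EFinP.
  rewrite (eq_integral (EFin \o X)) => [|w _]; last by rewrite /= ger0_norm.
  by apply: le_lt_trans XB _; exact: ltry.
by split => //; rewrite -lee_fin /Rintegral fineK//; exact: integrable_fin_num.
Qed.

(** * The walk expansion for a Wigner process *)

Section wigner_process_facts.
Context (R : realType) (d : measure_display) (T : measurableType d).
Variables (P : probability T R) (beta : R) (r : nat -> R).
Variables (mu : probability (measurableTypeR R) R).
Variables (G : forall N : nat, nat -> random_entries P N).
Variables (lam : forall N : nat, 'I_N -> {RV P >-> R}).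
Arguments G : clear implicits.
Arguments lam : clear implicits.
Hypothesis G_wigner : stationary_wigner_process beta r G.
Hypothesis lam_iid : iid_diagonal mu lam.
Hypothesis lam_G_indep : diagonal_process_independent lam G.
Hypothesis mu_moments :
  forall k : nat, mu.-integrable setT (EFin \o (fun x : R => x ^+ k)).

Local Notation "\E f" := (Rintegral P setT f) (at level 10, f at next level).
Local Notation integrable f := (P.-integrable setT (EFin \o f)).

Lemma process_moments k K : (0 < k)%N -> (2 <= K)%N ->
  exists c, forall N i j, integrable (fun w => `|G N k i j w| ^+ K) /\
    \E (fun w => `|G N k i j w| ^+ K) <= c.
Proof.
case: G_wigner => r2 [_ /(_ k) W _ _] _ k0 K2.
have [_ _ _ _ [c cP]] := W k0; exists (c K) => N i j.
apply: integrable_expectation_le (cP N i j K K2).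
  by apply: measurable_funX; apply: measurableT_comp => //; exact: measurable_funPT.
by move=> w; rewrite exprn_ge0.
Qed.

(** The constants of the moment bounds may vary with time; a walk of [k] steps meets only the times
    1 to [k], so a finite maximum suffices. *)
Lemma process_moments_uniform k K : (2 <= K)%N ->
  exists2 c, 0 <= c & forall t N i j, (t < k)%N ->
    \E (fun w => `|G N t.+1 i j w| ^+ K) <= c.
Proof.
move=> K2; elim: k => [|k [c c0 cP]]; first by exists 0.
have [c' c'P] := process_moments (ltn0Sn k) K2.
exists (Num.max c c'); first by rewrite le_max c0.
move=> t N i j; rewrite ltnS leq_eqVlt => /predU1P[->|tk].
  by rewrite le_max (c'P N i j).2 orbT.
by rewrite le_max cP.
Qed.

Lemma process_centered N k i j : (0 < k)%N -> \E (G N k i j) = 0.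
Proof.
case: G_wigner => r2 [_ /(_ k) W _ _] _ k0.
have [_ _ C _ _] := W k0; have := C N i j.
by rewrite unlock /Rintegral => ->.
Qed.

Lemma process_cov N k m i j : i != j -> (0 < m)%N -> (m < k)%N ->
  \E (fun w => G N k i j w * G N m i j w) = beta ^+ 2 * r (k - m)%N.
Proof.
case: G_wigner => r2 [_ _ _ C] stat ij m0 mk.
have := C N i j k m ij m0 (ltnW mk).
rewrite unlock /Rintegral => -> /=; rewrite stat//; last exact: ltn_trans mk.
by congr (_ * r _); lia.
Qed.

Lemma process_mx_edge N k (x y : 'I_N) w : (0 < k)%N ->
  Gamma_mx (G N k) w x y = gam (G N) (edge x y, k) w.
Proof.
case: G_wigner => r2 [_ /(_ k) W _ _] _ k0; have [S _ _ _ _] := W k0.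
by rewrite mxE /gam /= prednK// /edge; case: ifP.
Qed.

Local Notation term N := (walk_term (G N) (lam N)).

Lemma process_integrable_term N x p : integrable (term N x p).
Proof.
apply: (integrable_walk_term mu_moments).
  by move=> j A mA; exact: (diagonal_law lam_iid).
by move=> k i j K k0 K2; have [c /(_ N i j)[]] := process_moments k0 K2.
Qed.

Lemma process_expectation_term N x p :
  \E (term N x p) = walk_weight (gam_moment (G N)) (moment mu) 0 1 x p.
Proof.
case: G_wigner => r2 [_ _ I _] _.
apply: expectation_walk_term => //.
- by move=> j A mA; exact: (diagonal_law lam_iid).
- exact: (diagonal_indep lam_iid).
- by move=> k i j K k0 K2; have [c /(_ N i j)[]] := process_moments k0 K2.
Qed.

Lemma steps_times s N (x : 'I_N) p z :
  z \in steps s x p -> (s <= z.2 < s + size p)%N.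
Proof.
elim: p s x => //= v p IH s x; rewrite inE => /predU1P[->|/IH] /=; lia.
Qed.

Lemma process_weight_bound k : exists2 C, 0 <= C &
  forall N (x : 'I_N) p, size p = k ->
  `|walk_weight (gam_moment (G N)) (moment mu) 0 1 x p| <= C.
Proof.
(* There are [k.+1] diagonal factors and [k] entries of the process; the extra 2 keeps the exponent
   at least 2. *)
pose K := (k.+1 + k).+2.
have [c c0 cP] := @process_moments_uniform k K isT.
pose a := Rintegral mu setT (fun x : R => `|x| ^+ K).
have a0 : 0 <= a by apply: Rintegral_ge0 => x _; rewrite exprn_ge0.
exists (1 + (a *+ k.+1 + c *+ k)).
  by rewrite addr_ge0// addr_ge0// mulrn_wge0.
move=> N x p sp; rewrite -process_expectation_term.
pose X := walk_variable (G N) (lam N).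
pose s : seq ('I_N + 'I_N * 'I_N * nat) := map inl (x :: p) ++ map inr (steps 1 x p).
have size_steps : size (steps 1 x p) = k.
  by rewrite -(size_map fst) map_fst_steps size_edges.
have -> : \E (term N x p) = \E (fun w => \prod_(i <- s) X i w).
  by apply: eq_Rintegral => w _; exact: walk_termE.
apply: le_trans (norm_expectation_prod_le (k := K) _ _ _ _) _ => //.
- exact: measurable_walk_variable.
- apply: walk_variable_moments => //.
    by move=> j A mA; exact: (diagonal_law lam_iid).
  by move=> k' i j K' k0 K2; have [c' /(_ N i j)[]] := process_moments k0 K2.
- by rewrite size_cat !size_map size_steps /= sp /K; lia.
rewrite lerD2l big_cat !big_map lerD//.
  rewrite (eq_bigr (fun=> a)) => [|v _]; last first.
    by apply: expectation_rv_norm_exp => // A mA; exact: (diagonal_law lam_iid).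
  by rewrite big_const_seq count_predT iter_addr addr0 /= sp.
apply: (@le_trans _ _ (\sum_(z <- steps 1 x p) c)).
  rewrite big_seq [leRHS]big_seq; apply: ler_sum => z /steps_times.
  by rewrite sp add1n ltnS => /andP[z1 zk]; apply: cP; rewrite prednK.
by rewrite big_const_seq count_predT iter_addr addr0 size_steps.
Qed.

Lemma mean_trace_walks k N : (0 < N)%N -> mean_trace G lam k N =
  (N%:R^-1 * (N%:R `^ (- (k%:R / 2)) *
   \sum_x \sum_(p <- words N k | last x p == x)
     walk_weight (gam_moment (G N)) (moment mu) 0 1 x p))%:E.
Proof.
move=> N0; rewrite /mean_trace EFinM; congr (_ * _)%E.
pose ws x := [seq p <- words N k | last x p == x].
pose S w := \sum_x \sum_(p <- ws x) term N x p w.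
have trE w : \tr (Q_mx (G N) (lam N) k w) = N%:R `^ (- (k%:R / 2)) * S w.
  rewrite /Q_mx mxtraceZ; congr (_ * _).
  rewrite (@trace_walks N R (fun m => Gamma_mx (G N m) w)
    (fun z => gam (G N) z w) (fun j => lam N j w)) // => [|m x y m0].
    by apply: eq_bigr => x _; rewrite big_filter.
  exact: process_mx_edge.
have iSx x : integrable (fun w => \sum_(p <- ws x) term N x p w).
  by apply: integrable_sumr => p; exact: process_integrable_term.
have iS : integrable S by exact: integrable_sumr.
rewrite unlock; under eq_integral do rewrite trE EFinM.
rewrite integralZl// EFinM; congr (_ * _)%E.
rewrite -[LHS]fineK; last exact: integrable_fin_num.
congr EFin; rewrite -/(Rintegral P setT S) Rintegral_sum//.
apply: eq_bigr => x _; rewrite Rintegral_sum => [|p]; last first.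
  exact: process_integrable_term.
by rewrite big_filter; apply: eq_bigr => p _; exact: process_expectation_term.
Qed.

End wigner_process_facts.

Theorem theorem3 (R : realType) (d : measure_display) (T : measurableType d)
  (P : probability T R) (beta : R) (r : nat -> R)
  (mu : probability (measurableTypeR R) R)
  (G : forall N : nat, nat -> random_entries P N)
  (lam : forall N : nat, 'I_N -> {RV P >-> R}) :
  stationary_wigner_process beta r G ->
  iid_diagonal mu lam ->
  diagonal_process_independent lam G ->
  (forall k : nat, mu.-integrable setT (EFin \o (fun x : R => x ^+ k))) ->
  moment mu 1 = 1 ->
  [/\ forall k : nat, mean_trace G lam (2 * k) N @[N --> \oo] -->
        (even_limit beta r mu k)%:E,
      forall k : nat, mean_trace G lam (2 * k + 1) N @[N --> \oo] --> 0%E,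
      forall l : nat -> R,
        (forall k : nat, (1 <= k)%N ->
           cvgn (pseries l k%:R) /\
           stationary_weights beta r k = limn (pseries l k%:R) / k%:R) ->
        fps_deriv (Y_series beta r mu) =1
          fps_theta1 (fun x : R => limn (pseries l x))
            (fps_comp (psi mu) (Y_series beta r mu)) &
      fps_from1 (fun k => even_limit beta r mu k.-1) =1
        fps_mul (@fpsX R) (fps_comp (psi mu) (Y_series beta r mu))].
Proof.
move=> G_wigner lam_iid lam_G mu_int _.
(* Gives the factor 1 to the vertices that a walk does not visit. *)
have moment0 : moment mu 0 = 1.
  rewrite -[RHS](expectation1 mu); apply: eq_Rintegral => x _.
  by rewrite expr0.
pose W k := beta ^+ 2 * r k.
pose weight N := walk_weight (gam_moment (G N)) (moment mu) 0 1.
pose S k N := \sum_x \sum_(p <- words N k | last x p == x) weight N x p.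
have M_pair N (x y : 'I_N) s t : x != y -> (0 < s)%N -> (s < t)%N ->
    gam_moment (G N) (edge x y) [:: s; t] = W (t - s)%N.
  by apply: gam_moment_pair => *; exact: (process_cov G_wigner).
have M_single N e t : gam_moment (G N) e [:: t] = 0.
  by apply: gam_moment1 => *; exact: (process_centered G_wigner).
have M_nil N e : gam_moment (G N) e [::] = 1 by exact: gam_moment_nil.
(* The walk expansion is used for N > 0, hence the eventual equality; it also replaces the extended
   real sequence by a real one. *)
have meanE k u : (\forall N \near \oo,
      N%:R^-1 * (N%:R `^ (- (k%:R / 2)) * S k N) = u N) ->
    forall l : R, u N @[N --> \oo] --> l -> mean_trace G lam k N @[N --> \oo] --> l%:E.
  move=> uE l ul; have ulE : (u N)%:E @[N --> \oo] --> l%:E.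
    by apply: cvg_EFin; [exact: nearW | exact: ul].
  apply: cvg_trans; last exact: ulE.
  apply: near_eq_cvg; near=> N.
  rewrite (mean_trace_walks G_wigner lam_iid lam_G mu_int); last first.
    by near: N; exists 1%N.
  by congr EFin; apply/esym; near: N.
split.
- move=> n; rewrite mul2n.
  have [C C0 Cle] := process_weight_bound G_wigner lam_iid lam_G mu_int n.*2.
  pose u N := S n.*2 N / N%:R ^+ n.+1.
  apply: (meanE _ u).
    near=> N; have N0 : (0 < N)%N by near: N; exists 1%N.
    have NR0 : (N%:R : R) != 0 by rewrite pnatr_eq0 -lt0n.
    have -> : n.*2%:R / 2 = n%:R :> R by rewrite -muln2 natrM mulfK.
    by rewrite powRN powR_mulrn// /u exprS invfM mulrA mulrC.
  pose v N : R := (N ^_ n.+1)%:R / N%:R ^+ n.+1 * even_limit beta r mu n.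
  (* The error C (2n+1)! N^n of [walk_sum_even], divided by N^(n+1). *)
  pose b N : R := C * (n.*2.+1)`!%:R * N%:R^-1.
  apply: (@cvg_near_scaled _ u v b).
  + near=> N; have N0 : (0 < N)%N by near: N; exists 1%N.
    have NR0 : 0 < (N%:R : R) by rewrite ltr0n.
    have := @walk_sum_even N R N0 (gam_moment (G N)) (moment mu) W (M_nil N) moment0
      (M_single N) (M_pair N) (shifted_limit beta r mu) (shifted_limit0 beta r mu)
      _ n.*2 C C0 (Cle N) n erefl.
    rewrite shifted_limit_even => Sle.
    rewrite /u /v /b mulrAC -mulrBl normrM.
    rewrite [X in _ * X <= _]ger0_norm ?invr_ge0 ?exprn_ge0 ?ler0n//
      ler_pdivrMr ?exprn_gt0//.
    apply: le_trans (Sle _) _.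
      move=> j m; rewrite shifted_limitS; apply: eq_bigr => a _.
      (* The delay [a.*2.+1] between the two traversals is [2 * a.+1 - 1], the argument of [r] in
         the weight of index [a.+1]. *)
      by congr (_ * _ * _); rewrite /stationary_weights; congr (_ * r _); lia.
    by rewrite natrM natrX -!mulrA exprS mulKf// gt_eqF.
  + rewrite -[X in _ --> X]mul1r; apply: cvgMl; exact: cvg_ffact_ratio.
  + rewrite -(mulr0 (C * (n.*2.+1)`!%:R)); apply: cvgMr; exact: cvg_invn.
- move=> n; rewrite mul2n addn1.
  have [C C0 Cle] := process_weight_bound G_wigner lam_iid lam_G mu_int n.*2.+1.
  (* The power N^(n+1) compensates the number of walks; the half power left over tends to 0. *)
  pose u N := S n.*2.+1 N / N%:R ^+ n.+1 * Num.sqrt (N%:R^-1).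
  apply: (meanE _ u).
    near=> N; have N0 : (0 < N)%N by near: N; exists 1%N.
    have NR0 : (N%:R : R) != 0 by rewrite pnatr_eq0 -lt0n.
    have -> : n.*2.+1%:R / 2 = n%:R + 2^-1 :> R.
      by rewrite -addn1 -muln2 natrD natrM mulrDl mulfK// mul1r.
    rewrite powRN powRD ?NR0 ?implybT// powR_mulrn// powR12_sqrt// /u sqrtrV//.
    by rewrite exprS !invfM; ring.
  pose b N : R := C * (n.*2.+2)`!%:R * Num.sqrt (N%:R^-1).
  apply: (@cvg_near_scaled _ u (cst 0) b); last 2 first.
  + exact: cvg_cst.
  + rewrite -(mulr0 (C * (n.*2.+2)`!%:R)); apply: cvgMr; exact: cvg_sqrt_invn.
  near=> N; have N0 : (0 < N)%N by near: N; exists 1%N.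
  have NR0 : 0 < (N%:R : R) by rewrite ltr0n.
  have Sle := @walk_sum_odd N R N0 (gam_moment (G N)) (moment mu)
      (M_single N) n.*2.+1 C C0 (Cle N) n erefl.
  rewrite subr0 /u /b normrM [X in _ * X <= _]ger0_norm ?sqrtr_ge0//.
  rewrite ler_wpM2r ?sqrtr_ge0// normrM.
  rewrite [X in _ * X <= _]ger0_norm ?invr_ge0 ?exprn_ge0 ?ler0n//
      ler_pdivrMr ?exprn_gt0//.
  by apply: le_trans Sle _; rewrite natrM natrX mulrA.
- move=> l lP; apply: Y_series_ode => k k0; exact: (lP k k0).2.
- exact: even_limit_series.
Unshelve. all: by end_near. Qed.
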